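(* Let $\mathcal S,\mathcal T$ be closed subspaces of $\mathcal H$, each of infinite dimension and infinite codimension. The following are equivalent: (1) $(P_{\mathcal S},P_{\mathcal T})\in\mathbf\Gamma$, $\dim(\mathcal S\cap\mathcal T^\perp)<\infty$ and $\dim(\mathcal S^\perp\cap\mathcal T)<\infty$; (2) $(P_{\mathcal S},P_{\mathcal T^\perp})\in\mathcal C_1$ and $\mathrm{ind}(P_{\mathcal S},P_{\mathcal T^\perp})\neq 0$; that is, $P_{\mathcal S}P_{\mathcal T^\perp}$ is compact, $\dim(\mathcal S^\perp\cap\mathcal T)<\infty$, and $\dim(\mathcal S\cap\mathcal T^\perp)\ne\dim(\mathcal S^\perp\cap\mathcal T)$.
   Context: $\mathcal H$ is a separable infinite-dimensional complex Hilbert space, $\mathcal B(\mathcal H)$ the bounded operators, $\mathcal P(\mathcal H)=\{P\in\mathcal B(\mathcal H):P=P^2=P^*\}$. For a closed subspace $\mathcal S$, $P_{\mathcal S}$ denotes the orthogonal projection onto $\mathcal S$. Two closed subspaces $\mathcal S,\mathcal T$ have a common complement if there is a closed subspace $\mathcal Z$ with $\mathcal S\cap\mathcal Z=\mathcal T\cap\mathcal Z=\{0\}$ and $\mathcal S+\mathcal Z=\mathcal T+\mathcal Z=\mathcal H$. $\mathbf\Delta$ is the set of pairs $(P_{\mathcal S},P_{\mathcal T})$ such that $\mathcal S,\mathcal T$ have a common complement, and $\mathbf\Gamma=(\mathcal P(\mathcal H)\times\mathcal P(\mathcal H))\setminus\mathbf\Delta$. $\mathcal C=\{(P,Q)\in\mathcal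 P(\mathcal H)\times\mathcal P(\mathcal H): PQ\text{ compact}\}$, and $\mathcal C_1$ is the set of $(P,Q)\in\mathcal C$ with $P,Q$ of infinite rank and $\dim(N(P)\cap N(Q))<\infty$. For $(P,Q)\in\mathcal C_1$ (where also $\dim(R(P)\cap R(Q))<\infty$ since $PQ$ is compact), $\mathrm{ind}(P,Q)=\dim(R(P)\cap R(Q))-\dim(N(P)\cap N(Q))$, and $\mathcal C_1^n=\{(P,Q)\in\mathcal C_1:\mathrm{ind}(P,Q)=n\}$. *)

(* Defs.v *)
(* MathComp + MathComp-Analysis (classical layer) + real_closed complex.
   A complex Hilbert space is given abstractly: an lmodType over C := R[i]
   (R : realType) together with an inner product satisfying the Hilbert axioms,
   plus completeness, separability and infinite dimensionality. *)
From HB Require Import structures.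
From mathcomp Require Import all_boot all_order all_algebra.
From mathcomp Require Import boolp classical_sets reals.
From mathcomp.real_closed Require Import complex.

Set Implicit Arguments.
Unset Strict Implicit.
Unset Printing Implicit Defensive.

Import Order.TTheory GRing.Theory Num.Theory.
Local Open Scope ring_scope.

Section Hilbert.
Variables (R : realType) (V : lmodType R[i]) (ip : V -> V -> R[i]).

(* norm induced by the inner product *)
Definition hnorm (x : V) : R[i] := sqrtC (ip x x).

(* convergence / Cauchy sequences in the norm *)
Definition hconv (u : nat -> V) (l : V) : Prop :=
  forall e : R[i], 0 < e -> exists N : nat, forall n, (N <= n)%N -> hnorm (u n - l) < e.

Definition hcauchy (u : nat -> V) : Prop :=
  forall e : R[i], 0 < e -> exists N : nat,
    forall m n, (N <= m)%N -> (N <= n)%N -> hnorm (u m - u n) < e.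

(* linear independence of a finite family *)
Definition lin_indep (n : nat) (v : 'I_n -> V) : Prop :=
  forall c : 'I_n -> R[i], \sum_(i < n) c i *: v i = 0 -> forall i, c i = 0.

(* Axioms of a separable, infinite-dimensional complex Hilbert space
   (inner product linear in the first argument). *)
Definition is_sep_inf_hilbert : Prop :=
  (forall (a : R[i]) (x y z : V), ip (a *: x + y) z = a * ip x z + ip y z) /\
  (forall x y : V, ip x y = (ip y x)^*) /\
  (forall x : V, 0 <= ip x x) /\
  (forall x : V, ip x x = 0 -> x = 0) /\
  (forall u : nat -> V, hcauchy u -> exists l, hconv u l) /\
  (exists d : nat -> V, forall (x : V) (e : R[i]), 0 < e ->
      exists n, hnorm (x - d n) < e) /\
  (forall n : nat, exists v : 'I_n -> V, lin_indep v).

(* subsets of V are predicates (set V = V -> Prop) *)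
Definition is_subspace (S : set V) : Prop :=
  S 0 /\ forall (a : R[i]) (x y : V), S x -> S y -> S (a *: x + y).

Definition is_closed_set (S : set V) : Prop :=
  forall (u : nat -> V) (l : V), (forall n, S (u n)) -> hconv u l -> S l.

Definition closed_subspace (S : set V) : Prop := is_subspace S /\ is_closed_set S.

(* orthogonal complement *)
Definition orth (S : set V) : set V := fun x => forall y, S y -> ip x y = 0.

Definition setI2 (S T : set V) : set V := fun x => S x /\ T x.

(* S has (finite) dimension n: it has a linearly independent spanning
   family of n vectors lying in S *)
Definition has_dim (S : set V) (n : nat) : Prop :=
  exists v : 'I_n -> V,
    [/\ forall i, S (v i), lin_indep v &
        forall x, S x -> exists c : 'I_n -> R[i], x = \sum_(i < n) c i *: v i].

Definition finite_dim (S : set V) : Prop := exists n, has_dim S n.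

(* the dimension of a finite-dimensional subspace (junk value otherwise) *)
Definition fdim (S : set V) : nat := xget 0%N (fun n => has_dim S n).

(* orthogonal projection onto S: the y in S with x - y orthogonal to S
   (exists and is unique when S is a closed subspace) *)
Definition oproj (S : set V) (x : V) : V :=
  xget 0 (fun y => S y /\ forall z, S z -> ip (x - y) z = 0).

Definition range (A : V -> V) : set V := fun y => exists x, A x = y.
Definition kernel (A : V -> V) : set V := fun x => A x = 0.

Definition bounded_seq (u : nat -> V) : Prop :=
  exists M : R[i], forall n, hnorm (u n) <= M.

(* compact operator: maps bounded sequences to sequences having a
   convergent subsequence *)
Definition compact_op (A : V -> V) : Prop :=
  forall u : nat -> V, bounded_seq u ->
    exists phi : nat -> nat, (forall n, (phi n < phi n.+1)%N) /\
      exists l, hconv (fun n => A (u (phi n))) l.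

(* common complement *)
Definition common_complement (S T : set V) : Prop :=
  exists Z : set V, [/\ closed_subspace Z,
    (forall x, S x -> Z x -> x = 0),
    (forall x, T x -> Z x -> x = 0),
    (forall x, exists s z, [/\ S s, Z z & x = s + z])
  & (forall x, exists t z, [/\ T t, Z z & x = t + z])].

(* Delta / Gamma on pairs of orthogonal projections *)
Definition inDelta (P Q : V -> V) : Prop := common_complement (range P) (range Q).
Definition inGamma (P Q : V -> V) : Prop := ~ inDelta P Q.

(* the class C and C_1 *)
Definition inC (P Q : V -> V) : Prop := compact_op (fun x => P (Q x)).

Definition inC1 (P Q : V -> V) : Prop :=
  [/\ inC P Q, ~ finite_dim (range P), ~ finite_dim (range Q)
    & finite_dim (setI2 (kernel P) (kernel Q))].

(* index of a pair in C_1 *)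
Definition ind (P Q : V -> V) : int :=
  (fdim (setI2 (range P) (range Q)))%:Z - (fdim (setI2 (kernel P) (kernel Q)))%:Z.

End Hilbert.

(* Main.v *)
(** Write [P_S] for the orthogonal projection onto [S]; [A], the restriction of [P_T] to [S], has
    kernel [K], the intersection of [S] and [T^perp], and its range in [T] has orthogonal
    complement [N], the intersection of [S^perp] and [T].

    If [Z] is a common complement of [S] and [T] and [X = Z^perp], then [P_X] maps [S] and [T]
    isomorphically onto [X]. On [S], [P_X P_T] is [P_X] minus [P_X P_{T^perp}]; when
    [P_S P_{T^perp}] is compact this is an isomorphism minus a compact operator, so it has
    Fredholm index [0], which forces [dim K = dim N].

    Conversely, let [K] and [N] be finite dimensional and let [A = U B] be the polar
    decomposition. It suffices to find an isometry [W] from [S] onto [T] with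
    [Re <s, W s> >= - beta |s|^2] for some [beta < 1]: the orthogonal complement of
    [{s + W s}] is then a common complement. If [dim K = dim N], extend [U] by any isometry from
    [K] onto [N]. If [P_S P_{T^perp}] is not compact, there is an orthonormal sequence [e_n] in
    [S], orthogonal to [K], on which [B] is diagonal with entries at most [beta < 1]; then
    modify [U] by matching the bases [k_1, .., k_a, e_0, e_1, ..] and
    [c_1, .., c_b, U e_0, U e_1, ..], where the [k_i] and [c_i] are bases of [K] and [N]. *)
Require Import Defs.
From HB Require Import structures.
From mathcomp Require Import all_boot all_order all_algebra.
From mathcomp Require Import boolp classical_sets reals.
From mathcomp.real_closed Require Import complex.
From mathcomp Require Import zify ring lra.

Set Implicit Arguments.
Unset Strict Implicit.
Unset Printing Implicit Defensive.

Import Order.TTheory GRing.Theory Num.Theory.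
Local Open Scope ring_scope.
Local Open Scope classical_set_scope.

(** The isometry [W] is never built as an operator. It enters as a linear, norm preserving relation
    [G] with dense domain in [S] and dense range in [T]; bounds proved on pairs of [G] pass to
    closures, so finite combinations of the matched bases suffice. The lower bound for [W] comes
    from polarization. On vectors of [S], [W f] pairs like [B g] for a companion vector [g], and [4
    Re <f, B g> = <f + g, B (f + g)> - <f - g, B (f - g)>]. The first term is nonnegative, so only
    [h = f - g], a combination of matched basis vectors of [S], has to satisfy
    [<h, B h> <= beta |h|^2]. This is why [B] must be diagonal on the [e_n]: bounding each entry
    then bounds the whole form. In the other direction a common complement carries no estimates by
    itself; uniform boundedness turns the decomposition into lower bounds for projections. Index [0]
    is not defined as such: one dimension inequality is applied twice, to [P_S P_T] on [X] and to
    its adjoint [P_X P_T] on [S]. *)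

Section HilbertSpace.
Variables (R : realType) (V : lmodType R[i]) (ip : V -> V -> R[i]).
Hypothesis HV : is_sep_inf_hilbert ip.

(** * Inner product and norm *)

Local Notation "r %:C" := (real_complex R r).
Local Notation i_ := (Complex 0 1 : R[i]).
Implicit Types (x y z : V) (S T D X Z : set V).

Lemma ipPl a x y z : ip (a *: x + y) z = a * ip x z + ip y z.
Proof. by case: HV => h _; apply: h. Qed.

Lemma ipC x y : ip x y = (ip y x)^*.
Proof. by case: HV => _ [h _]; apply: h. Qed.

Lemma ip_ge0 x : 0 <= ip x x.
Proof. by case: HV => _ [_ [h _]]; apply: h. Qed.

Lemma ip0l y : ip 0 y = 0.
Proof.
have := ipPl 1 0 0 y; rewrite scaler0 addr0 mul1r => h.
by apply: (addrI (ip 0 y)); rewrite -h addr0.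
Qed.

Lemma ipDl x y z : ip (x + y) z = ip x z + ip y z.
Proof. by rewrite -{1}(scale1r x) ipPl mul1r. Qed.

Lemma ipZl a x z : ip (a *: x) z = a * ip x z.
Proof. by rewrite -(addr0 (a *: x)) ipPl ip0l addr0. Qed.

Lemma ipNl x z : ip (- x) z = - ip x z.
Proof. by rewrite -scaleN1r ipZl mulN1r. Qed.

Lemma ipBl x y z : ip (x - y) z = ip x z - ip y z.
Proof. by rewrite ipDl ipNl. Qed.

Lemma ip0r y : ip y 0 = 0.
Proof. by rewrite ipC ip0l rmorph0. Qed.

Lemma ipDr x y z : ip x (y + z) = ip x y + ip x z.
Proof. by rewrite ipC ipDl rmorphD /= -!ipC. Qed.

Lemma ipZr a x z : ip x (a *: z) = a^* * ip x z.
Proof. by rewrite ipC ipZl rmorphM /= -!ipC. Qed.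

Lemma ipNr x z : ip x (- z) = - ip x z.
Proof. by rewrite ipC ipNl rmorphN /= -!ipC. Qed.

Lemma ipBr x y z : ip x (y - z) = ip x y - ip x z.
Proof. by rewrite ipDr ipNr. Qed.

Lemma ip_suml (I : Type) (r : seq I) (P : pred I) (F : I -> V) y :
  ip (\sum_(i <- r | P i) F i) y = \sum_(i <- r | P i) ip (F i) y.
Proof. exact: (big_morph (ip^~ y) (fun a b => ipDl a b y) (ip0l y)). Qed.

Lemma ip_sumr (I : Type) (r : seq I) (P : pred I) (F : I -> V) y :
  ip y (\sum_(i <- r | P i) F i) = \sum_(i <- r | P i) ip y (F i).
Proof. exact: (big_morph (ip y) (fun a b => ipDr y a b) (ip0r y)). Qed.

Lemma ip_sym0 x y : ip x y = 0 -> ip y x = 0.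
Proof. by move=> h; rewrite ipC h rmorph0. Qed.

(** Norm estimates are run on this real inner product, with values in the ordered field [R]; complex
    identities are recovered by testing against [i y] as well. *)
Definition rip (x y : V) : R := complex.Re (ip x y).

Lemma ReD (a b : R[i]) : complex.Re (a + b) = complex.Re a + complex.Re b.
Proof. by case: a; case: b. Qed.

Lemma ReN (a : R[i]) : complex.Re (- a) = - complex.Re a.
Proof. by case: a. Qed.

Lemma Re_conj (a : R[i]) : complex.Re (a^*) = complex.Re a.
Proof. by case: a. Qed.

Lemma Re_real (r : R) (a : R[i]) : complex.Re (r%:C * a) = r * complex.Re a.
Proof. by case: a => u v /=; rewrite mul0r subr0. Qed.

Lemma conj_real (r : R) : (r%:C)^* = r%:C.
Proof. exact: conjc_real. Qed.

Lemma ripDl x y z : rip (x + y) z = rip x z + rip y z.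
Proof. by rewrite /rip ipDl ReD. Qed.

Lemma ripDr x y z : rip x (y + z) = rip x y + rip x z.
Proof. by rewrite /rip ipDr ReD. Qed.

Lemma ripNl x z : rip (- x) z = - rip x z.
Proof. by rewrite /rip ipNl ReN. Qed.

Lemma ripNr x z : rip x (- z) = - rip x z.
Proof. by rewrite /rip ipNr ReN. Qed.

Lemma ripBl x y z : rip (x - y) z = rip x z - rip y z.
Proof. by rewrite ripDl ripNl. Qed.

Lemma ripBr x y z : rip x (y - z) = rip x y - rip x z.
Proof. by rewrite ripDr ripNr. Qed.

Lemma ripC x y : rip x y = rip y x.
Proof. by rewrite /rip ipC Re_conj. Qed.

Lemma ripZl r x y : rip (r%:C *: x) y = r * rip x y.
Proof. by rewrite /rip ipZl Re_real. Qed.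

Lemma ripZr r x y : rip x (r%:C *: y) = r * rip x y.
Proof. by rewrite ripC ripZl ripC. Qed.

Lemma rip0l y : rip 0 y = 0.
Proof. by rewrite /rip ip0l. Qed.

Lemma rip0r y : rip y 0 = 0.
Proof. by rewrite /rip ip0r. Qed.

Lemma ip_rip x : ip x x = (rip x x)%:C.
Proof.
rewrite /rip; have /ger0_Im := ip_ge0 x.
by case: (ip x x) => a b /= ->.
Qed.

Lemma rip_ge0 x : 0 <= rip x x.
Proof. by rewrite -ler0c -ip_rip ip_ge0. Qed.

Lemma rip_eq0 x : rip x x = 0 -> x = 0.
Proof.
move=> h; case: HV => _ [_ [_ [h0 _]]]; apply: h0.
by rewrite ip_rip h.
Qed.

Lemma ip0_rip x y : ip x y = 0 -> rip x y = 0.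
Proof. by rewrite /rip => ->. Qed.

(** The real part of [<x, i y>] is the imaginary part of [<x, y>], the inner product being conjugate
    linear in its second argument. *)
Lemma rip_ip0 x y : rip x y = 0 -> rip x (i_ *: y) = 0 -> ip x y = 0.
Proof.
rewrite /rip ipZr; case: (ip x y) => a b /= -> /=.
by rewrite mul0r mulN1r opprK add0r => ->.
Qed.

Definition nrm (x : V) : R := Num.sqrt (rip x x).

Lemma nrm_ge0 x : 0 <= nrm x.
Proof. exact: sqrtr_ge0. Qed.

Lemma sqr_nrm x : nrm x ^+ 2 = rip x x.
Proof. by rewrite sqr_sqrtr // rip_ge0. Qed.

Lemma hnormE x : hnorm ip x = (nrm x)%:C.
Proof.
rewrite /hnorm ip_rip -sqr_nrm rmorphXn /=.
by rewrite sqrCK // ler0c nrm_ge0.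
Qed.

Lemma nrm0 : nrm 0 = 0.
Proof. by rewrite /nrm rip0l sqrtr0. Qed.

Lemma nrm_eq0 x : nrm x = 0 -> x = 0.
Proof. by move=> h; apply: rip_eq0; rewrite -sqr_nrm h expr0n. Qed.

Lemma nrmN x : nrm (- x) = nrm x.
Proof. by rewrite /nrm ripNl ripNr opprK. Qed.

Lemma nrmBC x y : nrm (x - y) = nrm (y - x).
Proof. by rewrite -nrmN opprB. Qed.

Lemma rip_le_sqr x y (r : R) : 0 <= r -> rip x x <= r ^+ 2 * rip y y -> nrm x <= r * nrm y.
Proof.
move=> r0 h; rewrite -(@ler_pXn2r _ 2) ?nnegrE ?mulr_ge0 ?nrm_ge0 //.
by rewrite exprMn !sqr_nrm.
Qed.

Lemma nrm_le x y : rip x x <= rip y y -> nrm x <= nrm y.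
Proof. by move=> h; rewrite -(mul1r (nrm y)); apply: rip_le_sqr => //; rewrite expr1n mul1r. Qed.

Lemma nrm_sqr_le x (r : R) : 0 <= r -> nrm x <= r -> rip x x <= r ^+ 2.
Proof. by move=> r0 h; rewrite -sqr_nrm ler_pXn2r // nnegrE ?nrm_ge0. Qed.

Lemma cauchy_schwarz x y : rip x y <= nrm x * nrm y.
Proof.
have [/eqP x0|x0] := boolP (nrm x == 0).
  by rewrite (nrm_eq0 x0) rip0l nrm0 mul0r.
have xp : 0 < nrm x by rewrite lt_def x0 nrm_ge0.
(* Expanded with [a = nrm x], [b = nrm y] and [c = rip x y], this reads [2ab(ab - c) >= 0]. *)
have := rip_ge0 ((nrm x)%:C *: y - (nrm y)%:C *: x).
rewrite !(ripBl, ripBr, ripZl, ripZr) -!sqr_nrm (ripC y x).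
have := nrm_ge0 y; set a := nrm x in xp *; set b := nrm y; set c := rip x y => b0 h.
have [/eqP b00|bn] := boolP (b == 0).
  by have -> : c = 0; [rewrite /c (nrm_eq0 b00) rip0r | rewrite b00 mulr0].
have bp : 0 < b by rewrite lt_def bn.
have : 0 <= (a * b) * (a * b - c) by nra.
by rewrite pmulr_rge0 ?mulr_gt0 // subr_ge0.
Qed.

Lemma cauchy_schwarzN x y : - (nrm x * nrm y) <= rip x y.
Proof. by have := cauchy_schwarz (- x) y; rewrite ripNl nrmN; lra. Qed.

Lemma cauchy_schwarz_abs x y : `|rip x y| <= nrm x * nrm y.
Proof. by rewrite ler_norml cauchy_schwarzN cauchy_schwarz. Qed.

Lemma nrmD x y : nrm (x + y) <= nrm x + nrm y.
Proof.
rewrite -(@ler_pXn2r _ 2) ?nnegrE ?addr_ge0 ?nrm_ge0 //.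
rewrite sqr_nrm sqrrD !sqr_nrm ripDl !ripDr (ripC y x).
by have := cauchy_schwarz x y; lra.
Qed.

Lemma nrmB x y : nrm (x - y) <= nrm x + nrm y.
Proof. by rewrite -(nrmN y); apply: nrmD. Qed.

Lemma nrm_tri x y z : nrm (x - z) <= nrm (x - y) + nrm (y - z).
Proof. by have := nrmD (x - y) (y - z); rewrite addrA subrK. Qed.

Lemma nrmZr r x : nrm (r%:C *: x) = `|r| * nrm x.
Proof. by rewrite /nrm ripZl ripZr mulrA -expr2 sqrtrM ?sqr_ge0 // sqrtr_sqr. Qed.

Lemma rip_parallelogram x y :
  rip (x + y) (x + y) + rip (x - y) (x - y) = 2 * rip x x + 2 * rip y y.
Proof. rewrite !(ripDl, ripDr, ripNl, ripNr); ring. Qed.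

Lemma rip_normZ (a : R[i]) x y : rip (a *: x) (a *: y) = (complex.Re a ^+ 2 + complex.Im a ^+ 2) * rip x y.
Proof.
rewrite /rip ipZl ipZr mulrA; case: a => a b; case: (ip x y) => c d /=; ring.
Qed.

Lemma scale_half x : (2^-1)%:C *: (x + x) = x.
Proof.
rewrite scalerDr -scalerDl -rmorphD /= (_ : 2^-1 + 2^-1 = 1 :> R); last by field.
by rewrite rmorph1 scale1r.
Qed.

Lemma le_eps (a b : R) : (forall e : R, 0 < e -> a <= b + e) -> a <= b.
Proof. by move=> h; apply/ler_addgt0Pr. Qed.

(** * Convergence and orthogonal projections *)

Definition cvs (u : nat -> V) (l : V) : Prop :=
  forall e : R, 0 < e -> exists N, forall n, (N <= n)%N -> nrm (u n - l) < e.

Definition cauchys (u : nat -> V) : Prop :=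
  forall e : R, 0 < e -> exists N, forall m n, (N <= m)%N -> (N <= n)%N ->
    nrm (u m - u n) < e.

Lemma gt0_real (e : R[i]) : 0 < e -> exists2 r : R, 0 < r & e = r%:C.
Proof.
case: e => a b; rewrite ltcE /= => /andP[/eqP -> a0]; by exists a.
Qed.

Lemma hconvP u l : hconv ip u l <-> cvs u l.
Proof.
split=> h e e0.
  have [|N hN] := h e%:C; first by rewrite ltcR.
  by exists N => n /hN; rewrite hnormE ltcR.
have [r r0 ->] := gt0_real e0; have [N hN] := h r r0.
by exists N => n /hN; rewrite hnormE ltcR.
Qed.

Lemma complete u : cauchys u -> exists l, cvs u l.
Proof.
move=> h; case: HV => _ [_ [_ [_ [hc _]]]].
have [|l hl] := hc u; last by exists l; apply/hconvP.
move=> e e0; have [r r0 ->] := gt0_real e0; have [N hN] := h r r0.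
by exists N => m n hm hn; rewrite hnormE ltcR hN.
Qed.

Lemma invn_lt (e : R) : 0 < e -> exists N, forall n, (N <= n)%N -> n.+1%:R^-1 < e.
Proof.
move=> e0; exists (Num.bound e^-1) => n hn.
rewrite -(invrK e) ltf_pV2 ?posrE ?invr_gt0 ?ltr0n //.
apply: (lt_le_trans (archi_boundP _)); first by rewrite invr_ge0 ltW.
by rewrite ler_nat; lia.
Qed.

Lemma nrm_lt x (e : R) : 0 < e -> rip x x < e ^+ 2 -> nrm x < e.
Proof. by move=> e0 h; rewrite -(@ltr_pXn2r _ 2) ?nnegrE ?nrm_ge0 ?(ltW e0) // sqr_nrm. Qed.

Lemma cvs_unique u l l' : cvs u l -> cvs u l' -> l = l'.
Proof.
move=> h h'; apply/eqP; rewrite -subr_eq0; apply/eqP/nrm_eq0/eqP.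
rewrite eq_le nrm_ge0 andbT; apply: le_eps => e e0; rewrite add0r.
have e2 : 0 < e / 2 by lra.
have [N hN] := h _ e2; have [N' hN'] := h' _ e2.
have := hN (maxn N N') (leq_maxl _ _); have := hN' (maxn N N') (leq_maxr _ _).
have := nrm_tri l (u (maxn N N')) l'; rewrite (nrmBC l (u _)); lra.
Qed.

Lemma cvs_cauchy u l : cvs u l -> cauchys u.
Proof.
move=> h e e0; have e2 : 0 < e / 2 by lra.
have [N hN] := h _ e2; exists N => m n hm hn.
have := hN m hm; have := hN n hn; have := nrm_tri (u m) l (u n).
rewrite (nrmBC l); lra.
Qed.

Lemma cvs_lipschitz (f : V -> V) (C : R) u l :
  (forall n, nrm (f (u n) - f l) <= C * nrm (u n - l)) ->
  cvs u l -> cvs (fun n => f (u n)) (f l).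
Proof.
move=> hf h e e0; have C1 : 0 < `|C| + 1 by have := normr_ge0 C; lra.
have [|N hN] := h (e / (`|C| + 1)); first by rewrite divr_gt0.
exists N => n /hN; rewrite ltr_pdivlMr // => hn; apply: (le_lt_trans (hf n)).
apply: le_lt_trans hn; rewrite mulrC ler_wpM2l ?nrm_ge0 //.
by have := ler_norm C; lra.
Qed.

Lemma cvsD u v l k : cvs u l -> cvs v k -> cvs (fun n => u n + v n) (l + k).
Proof.
move=> hu hv e e0; have e2 : 0 < e / 2 by lra.
have [N hN] := hu _ e2; have [M hM] := hv _ e2.
exists (maxn N M) => n; rewrite geq_max => /andP[/hN h1 /hM h2].
by have := nrmD (u n - l) (v n - k); rewrite addrACA -opprD; lra.
Qed.

Lemma cvs_subseq u l (phi : nat -> nat) :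
  (forall n, (n <= phi n)%N) -> cvs u l -> cvs (fun n => u (phi n)) l.
Proof.
move=> hp h e e0; have [N hN] := h e e0; exists N => n hn.
by apply: hN; apply: leq_trans (hp n).
Qed.

Definition adh (D : set V) : set V :=
  fun x => forall e : R, 0 < e -> exists2 y, D y & nrm (x - y) < e.

Lemma adh_seq D x : adh D x -> exists2 u : nat -> V, (forall n, D (u n)) & cvs u x.
Proof.
move=> h.
have /choice[u hu] : forall n : nat, exists y, D y /\ nrm (x - y) < n.+1%:R^-1.
  by move=> n; have [|y dy hy] := h n.+1%:R^-1; [rewrite invr_gt0 ltr0n | exists y].
exists u => [n|e e0]; first by case: (hu n).
have [N hN] := invn_lt e0; exists N => n /hN; rewrite nrmBC.
by apply: lt_trans; case: (hu n).
Qed.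

Lemma cvs_adh (D : set V) u x : (forall n, D (u n)) -> cvs u x -> adh D x.
Proof. by move=> hD h e /h[N hN]; exists (u N) => //; rewrite nrmBC hN. Qed.

Lemma sub_adh (D : set V) x : D x -> adh D x.
Proof. by move=> dx e e0; exists x => //; rewrite subrr nrm0. Qed.

Lemma is_closed_setP D : is_closed_set ip D <-> (forall x, adh D x -> D x).
Proof.
split=> h.
  by move=> x /adh_seq[u du hu]; apply: (h u) => //; apply/hconvP.
by move=> u l du /hconvP hl; apply: h; apply: cvs_adh hl.
Qed.

Lemma subspaceD S x y : is_subspace S -> S x -> S y -> S (x + y).
Proof. by move=> [_ h] sx sy; rewrite -(scale1r x); apply: h. Qed.

Lemma subspaceZ S a x : is_subspace S -> S x -> S (a *: x).
Proof. by move=> [h0 h] sx; rewrite -(addr0 (a *: x)); apply: h. Qed.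

Lemma subspaceN S x : is_subspace S -> S x -> S (- x).
Proof. by move=> h sx; rewrite -scaleN1r; apply: subspaceZ. Qed.

Lemma subspaceB S x y : is_subspace S -> S x -> S y -> S (x - y).
Proof. by move=> h sx sy; apply: subspaceD => //; apply: subspaceN. Qed.

Lemma subspace_sum (I : Type) (r : seq I) (P : pred I) (F : I -> V) S :
  is_subspace S -> (forall i, P i -> S (F i)) -> S (\sum_(i <- r | P i) F i).
Proof.
move=> h hF; apply: (big_ind S) => //; first by case: h.
by move=> x y; apply: subspaceD.
Qed.

Lemma adh_subspace D : is_subspace D -> is_subspace (adh D).
Proof.
move=> hD; split; first by apply: sub_adh; case: hD.
move=> a x y hx hy e e0.
have [u hu ux] := adh_seq hx; have [v hv vy] := adh_seq hy.
have [|N hN] := @cvsD (fun n => a *: u n) v (a *: x) y _ vy e e0.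
- apply: (@cvs_lipschitz (fun x => a *: x) (Num.sqrt (complex.Re a ^+ 2 + complex.Im a ^+ 2))) => // n.
  apply: rip_le_sqr; first exact: sqrtr_ge0.
  by rewrite -scalerBr rip_normZ sqr_sqrtr // addr_ge0 ?sqr_ge0.
- exists (a *: u N + v N); last by rewrite nrmBC hN.
  by case: hD => _; apply.
Qed.

Lemma adh_closed D : is_closed_set ip (adh D).
Proof.
apply/is_closed_setP => x h e e0; have e2 : 0 < e / 2 by lra.
have [y hy xy] := h _ e2; have [z dz yz] := hy _ e2; exists z => //.
by have := nrm_tri x y z; lra.
Qed.

Lemma adh_closed_subspace D : is_subspace D -> closed_subspace ip (adh D).
Proof. by move=> h; split; [apply: adh_subspace | apply: adh_closed]. Qed.

Lemma closed_adh S x : closed_subspace ip S -> adh S x -> S x.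
Proof. by case=> _ /is_closed_setP h; apply: h. Qed.

(** The variational step at a minimum. The test value is [t = c / (q + 1)], where [q + 1] keeps the
    divisor positive when [q = 0]. *)
Lemma linear_le_quadratic (c q : R) : 0 <= q ->
  (forall t, 2 * t * c <= t ^+ 2 * q) -> c = 0.
Proof.
move=> q0 h; have := h (c / (q + 1)).
have q1 : 0 < q + 1 by lra.
have q2 : q + 1 != 0 by rewrite gt_eqF.
move=> hc; apply/eqP; rewrite -sqrf_eq0 eq_le sqr_ge0 andbT.
have : c ^+ 2 * (2 * (q + 1)) <= c ^+ 2 * q.
  have := ler_wpM2r (sqr_ge0 (q + 1)) hc.
  rewrite (_ : 2 * (c / (q + 1)) * c * _ = c ^+ 2 * (2 * (q + 1))); last by field.
  by rewrite (_ : (c / (q + 1)) ^+ 2 * q * _ = c ^+ 2 * q) //; field.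
have := sqr_ge0 c; set k := c ^+ 2 => k0 h'; nra.
Qed.

Lemma rip0_orth S w : is_subspace S -> (forall z, S z -> rip w z = 0) -> orth ip S w.
Proof. by move=> hS h z sz; apply: rip_ip0; apply: h => //; apply: subspaceZ. Qed.

(** A minimizing sequence for the distance from [x] to [S] is Cauchy by the parallelogram law; its
    limit is shown to be the projection by perturbing in every direction [z] of [S]. *)
Lemma projection_exists S x : closed_subspace ip S -> exists y, S y /\ orth ip S (x - y).
Proof.
move=> hS; have [hsub hcl] := hS.
pose D : set R := fun r => exists2 s, S s & r = rip (x - s) (x - s).
have Dinf : has_inf D.
  split; first by exists (rip (x - 0) (x - 0)); exists 0 => //; case: hsub.
  by exists 0 => _ [s _ ->]; apply: rip_ge0.
pose d := inf D.
have dlb s : S s -> d <= rip (x - s) (x - s).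
  by move=> ss; apply: inf_lbound; [case: Dinf | exists s].
have app (e : R) : 0 < e -> exists s, S s /\ rip (x - s) (x - s) < d + e.
  by move=> /inf_adherent /(_ Dinf)[_ [s ss ->] hs]; exists s.
have /choice[u hu] : forall n : nat, exists s, S s /\ rip (x - s) (x - s) < d + n.+1%:R^-1.
  by move=> n; apply: app; rewrite invr_gt0 ltr0n.
have [|y uy] := @complete u.
  (* The midpoint of [u m] and [u n] lies in [S], so [|u m - u n|^2] is at most [2/(m+1) + 2/(n+1)];
     hence the tolerance [e ^+ 2 / 4]. *)
  move=> e e0; have e4 : 0 < e ^+ 2 / 4 by rewrite divr_gt0 ?exprn_gt0.
  have [N hN] := invn_lt e4; exists N => m n /hN hm /hN hn.
  have [sm dm] := hu m; have [sn dn] := hu n; apply: nrm_lt => //.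
  have := dlb ((2^-1)%:C *: (u m + u n)) _.
  rewrite (_ : x - _ = (2^-1)%:C *: ((x - u m) + (x - u n))); last first.
    by rewrite addrACA -opprD scalerBr scale_half.
  rewrite ripZl ripZr => /(_ (subspaceZ _ hsub (subspaceD hsub sm sn))) hd.
  have := rip_parallelogram (x - u m) (x - u n).
  rewrite (_ : x - u m - (x - u n) = u n - u m); last by rewrite opprB addrC addrA subrK.
  have -> : rip (u n - u m) (u n - u m) = rip (u m - u n) (u m - u n).
    by rewrite -!sqr_nrm nrmBC.
  by move: hm hn dm dn hd; move: (m.+1%:R^-1) (n.+1%:R^-1) => im jn; lra.
have sy : S y by apply: (hcl u) => [n|]; [case: (hu n) | apply/hconvP].
exists y; split=> //; apply: rip0_orth => // z sz.
apply: (linear_le_quadratic (rip_ge0 z)) => t.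
(* The perturbation inequality holds at any [s] of [S] with the excess of [s] over the infimum as
   error. It is passed to the limit along [u]; the constant [c] below absorbs the error of replacing
   [y] by a term of [u]. *)
have key (s : V) : S s -> 2 * t * rip (x - s) z <= rip (x - s) (x - s) - d + t ^+ 2 * rip z z.
  move=> ss; have := dlb (s + t%:C *: z) (subspaceD hsub ss (subspaceZ _ hsub sz)).
  by rewrite opprD addrA; move: (x - s) => w; rewrite ripBl !(ripBr, ripZl, ripZr) (ripC z w); lra.
apply: le_eps => e e0.
pose c := `|2 * t| * nrm z + 1.
have c0 : 0 < c by rewrite /c; have := mulr_ge0 (normr_ge0 (2 * t)) (nrm_ge0 z); lra.
have [|N hN] := uy (e / 2 / c); first by rewrite !divr_gt0.
have [|M hM] := @invn_lt (e / 2); first by lra.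
have [sn dn] := hu (maxn N M).
have := hM _ (leq_maxr N M); have := hN _ (leq_maxl N M).
rewrite ltr_pdivlMr // => h1 h2; have := key _ sn.
set v := u (maxn N M) in sn dn h1 *.
have -> : rip (x - y) z = rip (x - v) z + rip (v - y) z by rewrite -ripDl addrA subrK.
rewrite mulrDr => h3.
have h4 : 2 * t * rip (v - y) z <= nrm (v - y) * c.
  apply: le_trans (ler_norm _) _; rewrite normrM.
  apply: le_trans (ler_wpM2l (normr_ge0 _) (cauchy_schwarz_abs _ _)) _.
  by rewrite /c mulrDr mulr1 mulrCA lerDl nrm_ge0.
by move: dn h2; move: ((maxn N M).+1%:R^-1) => q; lra.
Qed.

Local Notation P := (oproj ip).
Local Notation clsub := (closed_subspace ip).

Lemma clsub_sub S : clsub S -> is_subspace S.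
Proof. by case. Qed.

Lemma oproj_spec S x : clsub S -> S (P S x) /\ orth ip S (x - P S x).
Proof.
move=> /(projection_exists x)[y hy]; rewrite /oproj.
by case: xgetP => [z _ [sz hz]|/(_ y)]; [split | case; case: hy].
Qed.

Lemma oproj_in S x : clsub S -> S (P S x).
Proof. by case/(oproj_spec x). Qed.

Lemma oproj_orth S x : clsub S -> orth ip S (x - P S x).
Proof. by case/(oproj_spec x). Qed.

Lemma orth_self S x : S x -> orth ip S x -> x = 0.
Proof. by move=> sx /(_ x sx) /ip0_rip /rip_eq0. Qed.

Lemma orth_subspace S : is_subspace (orth ip S).
Proof.
split=> [y _|a x y hx hy z sz]; first exact: ip0l.
by rewrite ipPl hx // hy // mulr0 addr0.
Qed.

Lemma oproj_unique S x y : clsub S -> S y -> orth ip S (x - y) -> P S x = y.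
Proof.
move=> hS sy hy; have [sp hp] := oproj_spec x hS.
apply/eqP; rewrite -subr_eq0; apply/eqP/(@orth_self S).
  by apply: subspaceB => //; apply: clsub_sub.
have -> : P S x - y = (x - y) - (x - P S x) by rewrite opprB [RHS]addrC [RHS]addrA subrK.
exact: (subspaceB (orth_subspace S)).
Qed.

Lemma oproj_id S x : clsub S -> S x -> P S x = x.
Proof. by move=> hS sx; apply: oproj_unique => //; rewrite subrr; case: (orth_subspace S). Qed.

Lemma oproj_0 S x : clsub S -> orth ip S x -> P S x = 0.
Proof. by move=> hS sx; apply: oproj_unique => //; [case: hS => -[] | rewrite subr0]. Qed.

Lemma oprojP S a x y : clsub S -> P S (a *: x + y) = a *: P S x + P S y.
Proof.
move=> hS; have hs := clsub_sub hS; apply: oproj_unique => //.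
  by apply: subspaceD => //; [apply: subspaceZ => // |]; apply: oproj_in.
rewrite opprD addrACA -scalerBr; have ho := orth_subspace S.
by apply: (subspaceD ho); [apply: (subspaceZ _ ho) |]; apply: oproj_orth.
Qed.

Lemma orth_mem S x y : S x -> orth ip S y -> ip x y = 0.
Proof. by move=> sx h; apply: ip_sym0; apply: h. Qed.

Lemma ip_oprojl S x y : clsub S -> S y -> ip (P S x) y = ip x y.
Proof.
move=> hS sy; apply/eqP; rewrite eq_sym -subr_eq0 -ipBl; apply/eqP.
by apply: (oproj_orth x hS).
Qed.

Lemma ip_oproj S x y : clsub S -> ip (P S x) y = ip x (P S y).
Proof.
move=> hS; rewrite -(ip_oprojl x hS (oproj_in y hS)).
by rewrite [LHS]ipC [RHS]ipC (ip_oprojl y hS (oproj_in x hS)).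
Qed.

Lemma rip_oproj S x y : clsub S -> rip (P S x) y = rip x (P S y).
Proof. by move=> hS; rewrite /rip ip_oproj. Qed.

Lemma oproj_pythagoras S x : clsub S ->
  rip x x = rip (P S x) (P S x) + rip (x - P S x) (x - P S x).
Proof.
move=> hS; have : rip (P S x) (x - P S x) = 0.
  by apply/ip0_rip; apply: orth_mem (oproj_orth x hS); apply: oproj_in.
rewrite ripBl !ripBr (ripC x (P S x)); lra.
Qed.

Lemma nrm_oproj S x : clsub S -> nrm (P S x) <= nrm x.
Proof.
move=> hS; apply: nrm_le; rewrite [leRHS](oproj_pythagoras x hS).
by rewrite lerDl rip_ge0.
Qed.

Lemma orth_rip_adh S x y : orth ip S x -> adh S y -> rip x y = 0.
Proof.
move=> hx hy; apply/eqP; rewrite -normr_eq0 eq_le normr_ge0 andbT.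
apply: le_eps => e e0; rewrite add0r.
have n1 : 0 < nrm x + 1 by have := nrm_ge0 x; lra.
have [|s ss hs] := hy (e / (nrm x + 1)); first by rewrite divr_gt0.
rewrite -(subrK s y) ripDr (ip0_rip (hx s ss)) addr0.
apply: le_trans (cauchy_schwarz_abs _ _) _.
move: hs; rewrite ltr_pdivlMr // mulrDr mulr1.
by have := nrm_ge0 (y - s); rewrite mulrC; lra.
Qed.

Lemma orth_clsub S : clsub (orth ip S).
Proof.
split; first exact: orth_subspace.
apply/is_closed_setP => x hx y sy.
have h z : S z -> rip x z = 0.
  move=> sz; rewrite ripC; apply: orth_rip_adh hx => w hw.
  exact: orth_mem sz hw.
apply: rip_ip0; first exact: h.
rewrite ripC; apply: orth_rip_adh hx => w hw.
by rewrite ipZl (orth_mem sy hw) mulr0.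
Qed.

Lemma orth_orth S : clsub S -> orth ip (orth ip S) = S.
Proof.
move=> hS; apply/seteqP; split=> x hx; last by move=> y hy; apply: orth_mem hx hy.
have ho := oproj_orth x hS.
suff : x - P S x = 0 by move/eqP; rewrite subr_eq0 => /eqP ->; apply: oproj_in.
apply: (orth_self ho); apply: (subspaceB (orth_subspace _)) => //.
by move=> y hy; apply: orth_mem (oproj_in x hS) hy.
Qed.

Lemma oprojC S x : clsub S -> P (orth ip S) x = x - P S x.
Proof.
move=> hS; apply: oproj_unique; [exact: orth_clsub | exact: oproj_orth |].
by rewrite subKr => y hy; apply: orth_mem (oproj_in x hS) hy.
Qed.

Lemma range_oproj S : clsub S -> Defs.range (P S) = S.
Proof.
move=> hS; apply/seteqP; split=> [_ [x <-]|x sx]; first exact: oproj_in.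
by exists x; apply: oproj_id.
Qed.

Lemma kernel_oproj S : clsub S -> kernel (P S) = orth ip S.
Proof.
move=> hS; apply/seteqP; split=> x; last exact: oproj_0.
by rewrite /kernel => h; have := oproj_orth x hS; rewrite h subr0.
Qed.

Lemma setI2_clsub S T : clsub S -> clsub T -> clsub (setI2 S T).
Proof.
move=> hS hT; split.
  split; first by split; [case: hS => -[] | case: hT => -[]].
  move=> a x y [sx tx] [sy ty]; split; first by case: hS => -[_ h] _; apply: h.
  by case: hT => -[_ h] _; apply: h.
apply/is_closed_setP => x hx; split.
  by apply: closed_adh => // e /hx[y [sy ty] hy]; exists y.
by apply: closed_adh => // e /hx[y [sy ty] hy]; exists y.
Qed.

(** The component of [x] orthogonal to the closure of [D] stays in [S] and is orthogonal to [D], so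
    it vanishes. *)
Lemma dense_criterion S D : clsub S -> is_subspace D -> (forall x, D x -> S x) ->
  (forall x, S x -> orth ip D x -> x = 0) -> forall x, S x -> adh D x.
Proof.
move=> hS hD sDS h x sx; have hA := adh_closed_subspace hD.
suff : x - P (adh D) x = 0.
  by move/eqP; rewrite subr_eq0 => /eqP ->; apply: oproj_in.
apply: h.
  apply: subspaceB => //; first exact: clsub_sub.
  by apply: closed_adh => // e e0; have [y dy hy] := @oproj_in _ x hA _ e0; exists y => //; apply: sDS.
by move=> y dy; apply: (oproj_orth x hA); apply: sub_adh.
Qed.

(** * Maps that are linear on a subspace *)

Definition lin (f : V -> V) := forall (a : R[i]) x y, f (a *: x + y) = a *: f x + f y.

Definition lin_on S (f : V -> V) :=
  forall (a : R[i]) x y, S x -> S y -> f (a *: x + y) = a *: f x + f y.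

Lemma lin_onT f S : lin f -> lin_on S f.
Proof. by move=> h a x y _ _; apply: h. Qed.

Section LinOn.
Variables (S : set V) (f : V -> V).
Hypotheses (hS : is_subspace S) (hf : lin_on S f).

Lemma lin_on0 : f 0 = 0.
Proof.
have s0 : S 0 by case: hS.
have := hf (-1) s0 s0; rewrite scaler0 addr0 scaleN1r addNr => h; exact: h.
Qed.

Lemma lin_onD x y : S x -> S y -> f (x + y) = f x + f y.
Proof. by move=> sx sy; rewrite -{1}(scale1r x) hf // scale1r. Qed.

Lemma lin_onZ a x : S x -> f (a *: x) = a *: f x.
Proof. by move=> sx; rewrite -(addr0 (a *: x)) hf ?lin_on0 ?addr0 //; case: hS. Qed.

Lemma lin_onN x : S x -> f (- x) = - f x.
Proof. by move=> sx; rewrite -scaleN1r lin_onZ // scaleN1r. Qed.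

Lemma lin_onB x y : S x -> S y -> f (x - y) = f x - f y.
Proof. by move=> sx sy; rewrite lin_onD ?lin_onN //; apply: subspaceN. Qed.

Lemma lin_on_sum (I : Type) (r : seq I) (c : I -> R[i]) (v : I -> V) :
  (forall i, S (v i)) -> f (\sum_(i <- r) c i *: v i) = \sum_(i <- r) c i *: f (v i).
Proof.
move=> sv; elim: r => [|i r IH]; first by rewrite !big_nil lin_on0.
by rewrite !big_cons hf ?IH //; apply: subspace_sum => // j _; apply: subspaceZ.
Qed.

Lemma lin_on_image : is_subspace (f @` S).
Proof.
split; first by exists 0; [case: hS | apply: lin_on0].
move=> a _ _ [x sx <-] [y sy <-]; exists (a *: x + y); last exact: hf.
by case: hS => _; apply.
Qed.

(** The lower bound makes preimages of a convergent sequence of images Cauchy; the upper bound lets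
    [f] pass to their limit. *)
Lemma bounded_below_image_closed (C c : R) : is_closed_set ip S -> 0 < c ->
  (forall x, S x -> nrm (f x) <= C * nrm x) ->
  (forall x, S x -> c * nrm x <= nrm (f x)) -> clsub (f @` S).
Proof.
move=> cS c0 hC hc; split; first exact: lin_on_image.
apply/is_closed_setP => y /adh_seq[v hv cv].
have /choice[u hu] : forall n, exists x, S x /\ f x = v n.
  by move=> n; have [x sx <-] := hv n; exists x.
have [|l hl] := @complete u.
  move=> e e0; have [|N hN] := cvs_cauchy cv (e := c * e); first by rewrite mulr_gt0.
  exists N => m n hm hn; rewrite -(ltr_pM2l c0); apply: le_lt_trans (hN m n hm hn).
  have [[sm <-] [sn <-]] := (hu m, hu n).
  by rewrite -lin_onB //; apply: hc; apply: subspaceB.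
have sl : S l by apply: (cS u); [move=> n; case: (hu n) | apply/hconvP].
exists l => //; apply: (cvs_unique _ cv).
have -> : v = fun n => f (u n) by apply: funext => n; case: (hu n).
apply: cvs_lipschitz hl => n; rewrite -lin_onB //; last by case: (hu n).
by apply: hC; apply: subspaceB => //; case: (hu n).
Qed.

End LinOn.

Lemma oproj_lin S : clsub S -> lin (P S).
Proof. by move=> hS a x y; apply: oprojP. Qed.

(** * Compactness and finite dimension *)

Definition incr (phi : nat -> nat) := forall n, (phi n < phi n.+1)%N.

Lemma incr_lt phi m n : incr phi -> (m < n)%N -> (phi m < phi n)%N.
Proof.
move=> h; elim: n => // n IH; rewrite ltnS leq_eqVlt => /orP[/eqP -> //|/IH mn].
exact: ltn_trans mn (h n).
Qed.

Lemma incr_ge phi n : incr phi -> (n <= phi n)%N.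
Proof. by move=> h; elim: n => // n IH; apply: leq_ltn_trans (h n). Qed.

Lemma incr_comp phi psi : incr phi -> incr psi -> incr (phi \o psi).
Proof. by move=> h k n /=; apply: incr_lt. Qed.

Lemma infinite_subseq (Q : nat -> Prop) :
  (forall n, exists m, (n <= m)%N /\ Q m) -> exists phi, incr phi /\ forall n, Q (phi n).
Proof.
move=> /choice[f hf]; exists (fun n => iter n (fun m => f m.+1) (f 0)).
split=> [n|[|n]] /=; first by have [] := hf (iter n (fun m => f m.+1) (f 0)).+1.
  by have [] := hf 0.
by have [] := hf (iter n (fun m => f m.+1) (f 0)).+1.
Qed.

(** One of the two halves of an interval contains infinitely many terms of the sequence; this is
    repeated [k] times. *)
Lemma bisection k : forall (a L : R) (r : nat -> R), (forall n, a <= r n <= a + L) ->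
  exists phi, incr phi /\ exists b, forall n, b <= r (phi n) <= b + L / 2 ^+ k.
Proof.
elim: k => [|k IH] a L r hr.
  by exists id; split=> // ; exists a => n; rewrite expr0 divr1.
have step (b : R) : (forall n, exists m, (n <= m)%N /\ b <= r m <= b + L / 2) ->
    exists phi, incr phi /\ exists b, forall n, b <= r (phi n) <= b + L / 2 ^+ k.+1.
  move=> /infinite_subseq[phi [hphi h]].
  have [psi [hpsi [c hc]]] := IH b (L / 2) (fun n => r (phi n)) h.
  exists (phi \o psi); split; first exact: incr_comp.
  by exists c => n /=; rewrite exprS invfM mulrA; apply: hc.
have [h|h] := pselect (forall n, exists m, (n <= m)%N /\ a <= r m <= a + L / 2).
  exact: step h.
(* If the lower half is not met infinitely often, then from some [N] on every term lies in the upper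
   half. *)
apply: (step (a + L / 2)) => n.
move/existsNP: h => [N hN]; exists (maxn n N); split; first exact: leq_maxl.
have : ~ (a <= r (maxn n N) <= a + L / 2).
  by move=> h; apply: hN; exists (maxn n N); split=> //; apply: leq_maxr.
by have := hr (maxn n N) => /andP[h1 h2] /negP; rewrite h1 /= -ltNge => h3; lra.
Qed.

Lemma real_small_oscillation (r : nat -> R) (M e : R) : (forall n, `|r n| <= M) -> 0 < e ->
  exists phi, incr phi /\ forall i j, `|r (phi i) - r (phi j)| < e.
Proof.
move=> hr e0; have M0 : 0 <= M by apply: le_trans (hr 0%N).
have [|k hk] := @invn_lt (e / (2 * M + 1)); first by rewrite divr_gt0 //; lra.
have [|phi [hphi [b hb]]] := @bisection k (- M) (2 * M) r.
  by move=> n; have := hr n; rewrite ler_norml; lra.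
exists phi; split=> // i j.
have h2 : 2 * M / 2 ^+ k < e.
  have p2 : 0 < 2 ^+ k :> R by rewrite exprn_gt0.
  rewrite ltr_pdivrMr //; have := hk k (leqnn k).
  rewrite ltr_pdivlMr ?ltr_wpDl ?mulr_ge0 // => h.
  have hk1 : k.+1%:R <= 2 ^+ k :> R by rewrite -natrX ler_nat ltn_expl.
  have : e * k.+1%:R <= e * 2 ^+ k by rewrite ler_pM2l.
  apply: lt_le_trans; rewrite -ltr_pdivrMr ?ltr0n // mulrC.
  by apply: le_lt_trans h; rewrite ler_wpM2l ?invr_ge0 ?ler0n //; lra.
by have := hb i; have := hb j; rewrite ltr_norml; move: (2 * M / _) h2 => q; lra.
Qed.

(* Compactness of [A] on [S], with "convergent subsequence" weakened to "subsequence of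
   oscillation at most [e]", which is easier to establish and to combine. *)
Definition ctb (S : set V) (A : V -> V) := forall (u : nat -> V) (M : R),
  (forall n, S (u n)) -> (forall n, nrm (u n) <= M) -> forall e : R, 0 < e ->
  exists phi, incr phi /\ forall i j, nrm (A (u (phi i)) - A (u (phi j))) < e.

Lemma bounded_seqP u : bounded_seq ip u <-> exists M : R, forall n, nrm (u n) <= M.
Proof.
split=> [[M hM]|[M hM]]; last by exists M%:C => n; rewrite hnormE lecR.
by exists (complex.Re M) => n; have := hM n; rewrite hnormE lecE => /andP[].
Qed.

Lemma compact_ctb S A : compact_op ip A -> ctb S A.
Proof.
move=> h u M _ hM e e0; have [|phi [hphi [l /hconvP/cvs_cauchy hl]]] := h u.
  by apply/bounded_seqP; exists M.
have [N hN] := hl e e0; exists (fun n => phi (n + N)%N); split.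
  by move=> n; rewrite addSn.
by move=> i j; apply: hN; apply: leq_addl.
Qed.

(* Diagonal extraction. *)
Lemma ctb_extract S A u (M : R) : ctb S A -> (forall n, S (u n)) -> (forall n, nrm (u n) <= M) ->
  exists phi, incr phi /\ exists l, cvs (fun n => A (u (phi n))) l.
Proof.
move=> h su hM.
have /choice[F hF] : forall kp : nat * (nat -> nat), exists phi, incr phi /\
    forall i j, nrm (A (u (kp.2 (phi i))) - A (u (kp.2 (phi j)))) < kp.1.+1%:R^-1.
  move=> [k psi] /=; have [|||phi hphi] := h (fun n => u (psi n)) M _ _ k.+1%:R^-1.
  - by move=> n; apply: su.
  - by move=> n; apply: hM.
  - by rewrite invr_gt0 ltr0n.
  - by exists phi.
pose Phi := fix Phi k := if k is k'.+1 then Phi k' \o F (k, Phi k') else F (0%N, id).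
have PhiS k : Phi k.+1 = Phi k \o F (k.+1, Phi k) by [].
have incP k : incr (Phi k).
  elim: k => [|k IH]; first by have [] := hF (0%N, id).
  by rewrite PhiS; apply: incr_comp => //; have [] := hF (k.+1, Phi k).
have osc k i j : nrm (A (u (Phi k i)) - A (u (Phi k j))) < k.+1%:R^-1.
  case: k => [|k]; first by have [_] := hF (0%N, id); apply.
  by rewrite PhiS /=; have [_] := hF (k.+1, Phi k); apply.
(* Every later subsequence factors through [Phi k], so the tail of the diagonal inherits the
   oscillation bound of [Phi k]. *)
have fact d k i : exists m, Phi (d + k)%N i = Phi k m.
  elim: d i => [|d IH] i; first by exists i.
  by rewrite addSn PhiS /=; apply: IH.
exists (fun k => Phi k k); split.
  move=> n; rewrite PhiS /=; apply: incr_lt => //.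
  by apply: incr_ge; have [] := hF (n.+1, Phi n).
apply: complete => e e0; have [N hN] := invn_lt e0; exists N => m n hm hn.
case: (fact (m - N)%N N m) => i; case: (fact (n - N)%N N n) => j.
rewrite !subnK // => -> ->.
exact: lt_trans (osc N _ _) (hN N (leqnn N)).
Qed.

Lemma ctb_compact A : ctb setT A -> compact_op ip A.
Proof.
move=> h u /bounded_seqP[M hM].
have [//|phi [hp [l hl]]] := ctb_extract h _ hM.
by exists phi; split=> //; exists l; apply/hconvP.
Qed.

Lemma ctb_ext S A B : (forall x, S x -> A x = B x) -> ctb S A -> ctb S B.
Proof.
move=> eAB h u M su hM e e0; have [phi [hp hphi]] := h u M su hM e e0.
by exists phi; split=> // i j; rewrite -!eAB.
Qed.

Lemma ctbD S A B : ctb S A -> ctb S B -> ctb S (fun x => A x + B x).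
Proof.
move=> hA hB u M su hM e e0; have e2 : 0 < e / 2 by lra.
have [phi [hp hphi]] := hA u M su hM _ e2.
have [||psi [hq hpsi]] := hB (fun n => u (phi n)) M _ _ _ e2; [by move=> n | by move=> n |].
exists (phi \o psi); split; first exact: incr_comp.
move=> i j /=; rewrite opprD addrACA.
have := hphi (psi i) (psi j); have := hpsi i j.
by have := nrmD (A (u (phi (psi i))) - A (u (phi (psi j))))
  (B (u (phi (psi i))) - B (u (phi (psi j)))); lra.
Qed.

Lemma ctb_postcomp S X A f (C : R) : (forall x, S x -> X (A x)) ->
  (forall x y, X x -> X y -> nrm (f x - f y) <= C * nrm (x - y)) ->
  ctb S A -> ctb S (fun x => f (A x)).
Proof.
move=> AX hf hA u M su hM e e0; have C1 : 0 < `|C| + 1 by have := normr_ge0 C; lra.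
have [|phi [hp hphi]] := hA u M su hM (e / (`|C| + 1)); first by rewrite divr_gt0.
exists phi; split=> // i j; have := hphi i j; rewrite ltr_pdivlMr //.
apply: le_lt_trans; apply: le_trans (hf _ _ _ _) _; try exact: AX.
by rewrite mulrC ler_wpM2l ?nrm_ge0 //; have := ler_norm C; lra.
Qed.

Lemma ctb_precomp S S' A g (C : R) : (forall x, S' x -> S (g x)) ->
  (forall x, S' x -> nrm (g x) <= C * nrm x) -> ctb S A -> ctb S' (fun x => A (g x)).
Proof.
move=> gS hg hA u M su hM; apply: (hA (fun n => g (u n)) (`|C| * M)).
  by move=> n; apply: gS.
move=> n; apply: le_trans (hg _ (su n)) _.
apply: le_trans (ler_wpM2r (nrm_ge0 _) (ler_norm C)) _.
by rewrite ler_wpM2l.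
Qed.

Lemma ctb_real_rank1 S k d : ctb S (fun x => (rip x k)%:C *: d).
Proof.
move=> u M su hM e e0.
have d1 : 0 < nrm d + 1 by have := nrm_ge0 d; lra.
have [||phi [hp hphi]] := @real_small_oscillation (fun n => rip (u n) k) (M * nrm k) (e / (nrm d + 1)).
- move=> n; apply: le_trans (cauchy_schwarz_abs _ _) _.
  by rewrite ler_wpM2r ?nrm_ge0.
- by rewrite divr_gt0.
exists phi; split=> // i j; rewrite -scalerBl -rmorphB nrmZr.
have := hphi i j; rewrite ltr_pdivlMr // mulrDr mulr1; apply: le_lt_trans.
by rewrite lerDl.
Qed.

Lemma ip_split x k : ip x k = (rip x k)%:C + (rip x (i_ *: k))%:C * i_.
Proof.
by rewrite /rip ipZr; case: (ip x k) => a b /=; congr Complex; ring.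
Qed.

Lemma ctb_rank1 S k d : ctb S (fun x => ip x k *: d).
Proof.
apply: (ctb_ext _ (ctbD (@ctb_real_rank1 S k d) (@ctb_real_rank1 S (i_ *: k) (i_ *: d)))).
by move=> x _; rewrite [ip x k]ip_split scalerDl scalerA.
Qed.

Lemma ctb_finite_rank S n (k d : nat -> V) : ctb S (fun x => \sum_(i < n) ip x (k i) *: d i).
Proof.
elim: n => [|n IH].
  move=> u M _ _ e e0; exists id; split=> // i j.
  by rewrite !big_ord0 subrr nrm0.
apply: (ctb_ext _ (ctbD IH (@ctb_rank1 S (k n) (d n)))).
by move=> x _; rewrite big_ord_recr.
Qed.

Lemma ctb_separated S A u (M c : R) : ctb S A -> (forall n, S (u n)) ->
  (forall n, nrm (u n) <= M) -> 0 < c ->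
  (forall i j, (i < j)%N -> c <= nrm (A (u i) - A (u j))) -> False.
Proof.
move=> hA su hM c0 hc; have [phi [hp hphi]] := hA u M su hM c c0.
by have := hphi 0%N 1%N; rewrite ltNge hc.
Qed.

(** * Finite orthonormal systems and dimension *)

Definition fproj (k : nat -> V) (a : nat) x := \sum_(i < a) ip x (k i) *: k i.

(** A family is a sequence on [nat] with a separate length [a], so that it can be lengthened without
    changing its type. *)
Definition orthonormal (k : nat -> V) (a : nat) :=
  forall i j, (i < a)%N -> (j < a)%N -> ip (k i) (k j) = (i == j)%:R.

Lemma ip_fprojl k a x j : orthonormal k a -> (j < a)%N -> ip (fproj k a x) (k j) = ip x (k j).
Proof.
move=> hk ja; rewrite /fproj ip_suml (bigD1 (Ordinal ja)) //= ipZl hk // eqxx mulr1.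
rewrite big1 ?addr0 // => i; rewrite -val_eqE /= => ij.
by rewrite ipZl hk // (negbTE ij) mulr0.
Qed.

Lemma fproj_orth k a x j : orthonormal k a -> (j < a)%N -> ip (x - fproj k a x) (k j) = 0.
Proof. by move=> hk ja; rewrite ipBl ip_fprojl // subrr. Qed.

Lemma fproj_in k a x S : is_subspace S -> (forall i, (i < a)%N -> S (k i)) -> S (fproj k a x).
Proof. by move=> hS hk; apply: subspace_sum => // i _; apply: subspaceZ => //; apply: hk. Qed.

Lemma fprojP k a (c : R[i]) x y : fproj k a (c *: x + y) = c *: fproj k a x + fproj k a y.
Proof.
rewrite /fproj scaler_sumr -big_split /=; apply: eq_bigr => i _.
by rewrite ipPl scalerDl scalerA.
Qed.

Lemma orthonormal_lin_indep k a : orthonormal k a -> lin_indep (fun i : 'I_a => k i).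
Proof.
move=> hk c hc i; have : ip (\sum_(i < a) c i *: k i) (k i) = 0 by rewrite hc ip0l.
rewrite ip_suml (bigD1 i) //= ipZl hk // eqxx mulr1 big1 ?addr0 // => j ji.
by rewrite ipZl hk // val_eqE (negbTE ji) mulr0.
Qed.

Lemma nrm_gt0 x : x <> 0 -> 0 < nrm x.
Proof. by move=> x0; rewrite lt_def nrm_ge0 andbT; apply/eqP => /nrm_eq0. Qed.

Lemma rip_unit x : nrm x = 1 <-> ip x x = 1.
Proof.
rewrite ip_rip -sqr_nrm; split=> [->|]; first by rewrite expr1n.
move=> /(@complexI _ _ 1) /eqP; rewrite sqrf_eq1 => /orP[/eqP //|/eqP h].
by have := nrm_ge0 x; rewrite h; lra.
Qed.

Lemma normalize x : x <> 0 -> nrm ((nrm x)^-1%:C *: x) = 1.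
Proof.
move=> /nrm_gt0 x0; rewrite nrmZr ger0_norm ?invr_ge0 ?(ltW x0) //.
by rewrite mulVf // gt_eqF.
Qed.

(** Vectors depending on earlier ones are dropped, so [a] may be smaller than [n]. Quantifying over
    subspaces says that the [k i] lie in the span of the [v j]; the last clause gives the converse
    inclusion. *)
Lemma gram_schmidt n (v : nat -> V) : exists a k, [/\ orthonormal k a,
  (forall S, is_subspace S -> (forall j, (j < n)%N -> S (v j)) -> forall i, (i < a)%N -> S (k i)) &
  (forall j, (j < n)%N -> fproj k a (v j) = v j)].
Proof.
elim: n => [|n [a [k [ok sk pk]]]]; first by exists 0%N, (fun _ => 0); split=> // i j; rewrite ltn0.
have sk' S : is_subspace S -> (forall j, (j < n.+1)%N -> S (v j)) -> forall i, (i < a)%N -> S (k i).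
  by move=> hS hv; apply: sk => // j jn; apply: hv; apply: ltnW.
pose w := v n - fproj k a (v n).
have [w0|w0] := pselect (w = 0).
  exists a, k; split=> // j; rewrite ltnS leq_eqVlt => /orP[/eqP ->|/pk //].
  by move/eqP: w0; rewrite subr_eq0 => /eqP <-.
pose e := (nrm w)^-1%:C *: w; pose k' i := if (i < a)%N then k i else e.
have ke i : (i < a)%N -> ip e (k i) = 0 by move=> ia; rewrite ipZl fproj_orth // mulr0.
have ok' : orthonormal k' a.+1.
  move=> i j; rewrite /k' !ltnS => ia ja.
  have [ia'|ia'] := ltnP i a; have [ja'|ja'] := ltnP j a.
  - exact: ok.
  - by rewrite (ip_sym0 (ke _ ia')); case: eqP => // ij; move: ia' ja'; rewrite ij ltnNge => /negbTE ->.
  - by rewrite ke //; case: eqP => // ij; move: ia' ja'; rewrite ij leqNgt => /negbTE ->.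
  - have -> : i = j by apply/eqP; rewrite eqn_leq (leq_trans ia ja') (leq_trans ja ia').
    by rewrite eqxx; apply/rip_unit/normalize.
have fk x : fproj k' a.+1 x = fproj k a x + ip x e *: e.
  rewrite /fproj big_ord_recr /= /k' ltnn; congr (_ + _).
  by apply: eq_bigr => i _; rewrite ltn_ord.
exists a.+1, k'; split=> //.
  move=> S hS hv i _; rewrite /k'; case: ifP => ia; first exact: sk' hv i ia.
  apply: subspaceZ => //; apply: subspaceB => //; first exact: hv.
  by apply: fproj_in => //; apply: sk'.
have wk j : fproj k a (v j) = v j -> fproj k' a.+1 (v j) = v j.
  move=> h; rewrite fk h; suff -> : ip (v j) e = 0 by rewrite scale0r addr0.
  rewrite -h ip_suml big1 // => i _; by rewrite ipZl (ip_sym0 (ke _ _)) ?mulr0.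
move=> j; rewrite ltnS leq_eqVlt => /orP[/eqP ->|/pk]; last exact: wk.
rewrite fk -[RHS](subrK (fproj k a (v n))) addrC -/w; congr (_ + _).
have -> : ip (v n) e = ip w e.
  rewrite -[v n](subrK (fproj k a (v n))) -/w ipDl -[RHS]addr0; congr (_ + _).
  rewrite /fproj ip_suml big1 // => i _; by rewrite ipZl (ip_sym0 (ke _ _)) ?mulr0.
have n0 := nrm_gt0 w0.
rewrite /e scalerA ipZr conj_real ip_rip -!rmorphM -sqr_nrm /=.
by rewrite (_ : _ * _ * _ = 1) ?scale1r //; field; rewrite gt_eqF.
Qed.

(** The coefficient matrix has independent rows, so its rank [n] is at most its number [m] of
    columns. *)
Lemma lin_indep_span_le n m (v : 'I_n -> V) (w : 'I_m -> V) : lin_indep v ->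
  (forall i, exists c : 'I_m -> R[i], v i = \sum_j c j *: w j) -> (n <= m)%N.
Proof.
move=> hv /choice[c hc].
pose C := \matrix_(i < n, j < m) c i j.
suff /eqP <- : row_free C by apply: rank_leq_col.
apply: inj_row_free => u hu; apply/rowP => i; rewrite mxE.
apply: (hv (fun i => u 0 i)).
under eq_bigr do rewrite hc scaler_sumr.
rewrite exchange_big /= big1 // => j _.
under eq_bigr do rewrite scalerA.
rewrite -scaler_suml; have /rowP/(_ j) := hu; rewrite !mxE => hj.
rewrite (_ : \sum_i _ = 0) ?scale0r // -[RHS]hj.
by apply: eq_bigr => l _; rewrite mxE.
Qed.

Lemma has_dim_unique S n m : has_dim S n -> has_dim S m -> n = m.
Proof.
move=> [v [sv lv gv]] [w [sw lw gw]]; apply/eqP; rewrite eqn_leq; apply/andP; split.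
  by apply: (lin_indep_span_le lv (w := w)) => i; apply: gw.
by apply: (lin_indep_span_le lw (w := v)) => i; apply: gv.
Qed.

Lemma fdimE S n : has_dim S n -> fdim S = n.
Proof.
move=> h; rewrite /fdim; case: xgetP => [m _ hm|/(_ n) //].
exact: has_dim_unique hm h.
Qed.

Lemma orthonormal_has_dim S k a : orthonormal k a -> (forall i, (i < a)%N -> S (k i)) ->
  (forall x, S x -> fproj k a x = x) -> has_dim S a.
Proof.
move=> ok sk pk; exists (fun i : 'I_a => k i); split=> [i||x sx]; first exact: sk.
  exact: orthonormal_lin_indep.
by exists (fun i : 'I_a => ip x (k i)); rewrite -[LHS]pk.
Qed.

Lemma has_dim_orthonormal S n : is_subspace S -> has_dim S n -> exists k, [/\ orthonormal k n,
  (forall i, (i < n)%N -> S (k i)) & (forall x, S x -> fproj k n x = x)].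
Proof.
move=> hS hd; have [v [sv lv gv]] := hd.
(* Padding by [0] turns the basis into a sequence on [nat]; only its entries below [n] are used. *)
pose v' j := if insub j is Some i then v i else 0.
have v'E (i : 'I_n) : v' i = v i by rewrite /v' valK.
have [a [k [ok sk pk]]] := gram_schmidt n v'.
have skS : forall i, (i < a)%N -> S (k i).
  by apply: sk => // j jn; rewrite -[j]/(val (Ordinal jn)) v'E.
have pkS x : S x -> fproj k a x = x.
  move=> /gv[c ->].
  rewrite (@lin_on_sum setT (fproj k a)) //; last by move=> ? ? ? _ _; apply: fprojP.
  by apply: eq_bigr => i _; rewrite -v'E pk.
have -> : n = a by apply: has_dim_unique hd _; apply: orthonormal_has_dim pkS.
by exists k.
Qed.

(** For [e] in [S], orthogonality to [x] is orthogonality to [P S x]. If no such [e] existed, the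
    projections of the list would already span [S]. *)
Lemma infinite_dim_extend S (L : seq V) : clsub S -> ~ finite_dim S ->
  exists e, [/\ S e, nrm e = 1 & forall x, x \in L -> ip e x = 0].
Proof.
move=> hS; have hs := clsub_sub hS; apply: contra_notP => hno.
have [a [k [ok sk pk]]] := gram_schmidt (size L) (fun j => P S (nth 0 L j)).
have skS : forall i, (i < a)%N -> S (k i) by apply: sk => // j _; apply: oproj_in.
exists a; apply: (orthonormal_has_dim ok skS) => y sy.
apply/eqP; rewrite eq_sym -subr_eq0; apply/eqP.
set w := y - _; apply: contra_notP hno => w0.
have sw : S w by apply: subspaceB => //; apply: fproj_in.
exists ((nrm w)^-1%:C *: w); split; [exact: subspaceZ | exact: normalize |].
move=> x /(nthP 0)[j jL <-]; rewrite ipZl -(oproj_id hS sw) ip_oproj // -pk //.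
rewrite ip_sumr big1 ?mulr0 // => i _.
by rewrite ipZr fproj_orth // mulr0.
Qed.

(** The list [es n] records [L0] and, for each earlier choice, both the vector and its image under
    [B]. For symmetric [B] the one-sided relations in the conclusion make [B] diagonal on the
    sequence. *)
Lemma greedy_sequence (Q : set V) (B : V -> V) (L0 : seq V) :
  (forall L : seq V, exists e, Q e /\ forall x, x \in L -> ip e x = 0) ->
  exists e : nat -> V, [/\ forall n, Q (e n), forall n x, x \in L0 -> ip (e n) x = 0,
    forall m n, (m < n)%N -> ip (e n) (e m) = 0 &
    forall m n, (m < n)%N -> ip (e n) (B (e m)) = 0].
Proof.
move=> /choice[f hf].
pose es := fix es n := if n is n'.+1 then f (es n') :: B (f (es n')) :: es n' else L0.
have sub m n x : (m <= n)%N -> x \in es m -> x \in es n.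
  elim: n => [|n IH]; first by rewrite leqn0 => /eqP ->.
  by rewrite leq_eqVlt => /orP[/eqP -> //|/IH h /h h']; rewrite /= !inE h' !orbT.
exists (fun n => f (es n)); split=> [n|n x hx|m n mn|m n mn].
- by have [] := hf (es n).
- by have [_] := hf (es n); apply; apply: (sub 0%N).
- by have [_] := hf (es n); apply; apply: sub mn _; rewrite /= !inE eqxx.
- by have [_] := hf (es n); apply; apply: sub mn _; rewrite /= !inE eqxx orbT.
Qed.

(** Otherwise [S] contains an infinite orthonormal sequence, whose terms stay at mutual distance at
    least [1]. *)
Lemma compact_identity_finite_dim S : clsub S -> ctb S id -> finite_dim S.
Proof.
move=> hS hc; apply: contrapT => /(infinite_dim_extend _ hS) hex.
have [|e [he _ oe _]] := @greedy_sequence (fun e => S e /\ nrm e = 1) id [::].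
  by move=> L; have [e [se ne oe]] := hex L; exists e.
apply: (@ctb_separated S id e 1 1 hc) => // [n|n|i j ij].
- by case: (he n).
- by case: (he n) => _ ->.
rewrite -(ler_pXn2r (n := 2)) ?nnegrE ?nrm_ge0 ?ler01 // sqr_nrm expr1n.
rewrite ripBl !ripBr [rip (e i) (e j)]ripC (ip0_rip (oe _ _ ij)) -!sqr_nrm.
by case: (he i) => _ ->; case: (he j) => _ ->; lra.
Qed.

(** If every [eps] failed, then for each [eps] the unit vectors of [S] orthogonal to some finite
    list would have image under [P T] shorter than [eps]. This makes [P_S P_T] a uniform limit of
    finite rank operators, hence compact. *)
Lemma noncompact_extend S T : clsub S -> clsub T ->
  ~ compact_op ip (fun x => P S (P T x)) -> exists2 eps : R, 0 < eps &
  forall L : seq V, exists e, [/\ S e, nrm e = 1, eps <= nrm (P T e) & forall x, x \in L -> ip e x = 0].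
Proof.
move=> hS hT; apply: contra_notP => hno; apply: ctb_compact => u M _ hM e e0.
have hs := clsub_sub hS.
have M0 : 0 <= M by apply: le_trans (nrm_ge0 _) (hM 0%N).
pose eps := e / (4 * (M + 1)).
have eps0 : 0 < eps by rewrite divr_gt0 //; lra.
have [L hL] : exists L : seq V, forall e, S e -> nrm e = 1 ->
    (forall x, x \in L -> ip e x = 0) -> nrm (P T e) < eps.
  apply: contrapT => h; apply: hno; exists eps => // L.
  apply: contrapT => h'; apply: h; exists L => w sw nw ow.
  by rewrite ltNge; apply/negP => hw; apply: h'; exists w.
have [a [k [ok sk pk]]] := gram_schmidt (size L) (fun j => P S (nth 0 L j)).
have skS : forall i, (i < a)%N -> S (k i) by apply: sk => // j _; apply: oproj_in.
pose A x := P S (P T x).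
have nA x : nrm (A x) <= 1 * nrm x.
  by rewrite mul1r; apply: le_trans (nrm_oproj _ hS) (nrm_oproj _ hT).
(* The remainder [w] lies in [S], is orthogonal to the list, and satisfies
   [|w|^2 = <P_T w, x> <= eps |w| M]; [eps] was chosen so that [eps M <= e / 4]. *)
have small x : nrm x <= M -> nrm (A x - fproj k a (A x)) <= e / 4.
  move=> nx; set w := A x - _.
  have [->|w0] := pselect (w = 0); first by rewrite nrm0; lra.
  have sw : S w by apply: subspaceB => //; [apply: oproj_in | apply: fproj_in].
  have ow y : y \in L -> ip w y = 0.
    move=> /(nthP 0)[j jL <-]; rewrite -(oproj_id hS sw) ip_oproj // -pk //.
    by rewrite ip_sumr big1 // => i _; rewrite ipZr fproj_orth // mulr0.
  have n0 := nrm_gt0 w0.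
  have ow' y : y \in L -> ip ((nrm w)^-1%:C *: w) y = 0.
    by move=> hy; rewrite ipZl ow ?mulr0.
  have /ltW := hL _ (subspaceZ _ hs sw) (normalize w0) ow'.
  have -> : P T ((nrm w)^-1%:C *: w) = (nrm w)^-1%:C *: P T w.
    by rewrite (@lin_onZ setT) //; apply: lin_onT; apply: oproj_lin.
  rewrite nrmZr ger0_norm ?invr_ge0 ?nrm_ge0 // mulrC ler_pdivrMr // => hw.
  have : rip w w = rip (P T w) x.
    have -> : rip (P T w) x = rip w (A x) by rewrite /A -rip_oproj // (oproj_id hS sw) rip_oproj.
    have eA : A x = w + fproj k a (A x) by rewrite subrK.
    rewrite [in RHS]eA ripDr (_ : rip w (fproj _ _ _) = 0) ?addr0 //.
    apply: ip0_rip; rewrite ip_sumr big1 // => i _.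
    by rewrite ipZr fproj_orth // mulr0.
  rewrite -sqr_nrm expr2 => h.
  have : nrm w * nrm w <= nrm w * (eps * M).
    rewrite h; apply: le_trans (cauchy_schwarz _ _) _.
    by rewrite mulrA [nrm w * eps]mulrC ler_pM ?nrm_ge0.
  rewrite ler_pM2l // => hh; apply: le_trans hh _; rewrite /eps.
  rewrite mulrAC ler_pdivrMr; last by lra.
  by nra.
have hF : ctb setT (fun x => fproj k a (A x)).
  by apply: (@ctb_precomp setT setT (fproj k a) A 1) => //; apply: ctb_finite_rank.
have [//|| phi [hp hphi]] := hF u M _ hM (e / 2); first by lra.
exists phi; split=> // i j.
have h1 := small _ (hM (phi i)); have h2 := small _ (hM (phi j)); have h3 := hphi i j.
rewrite -/(A _) -/(A _).
set y := A (u (phi i)) in h1 h3 *; set z := A (u (phi j)) in h2 h3 *.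
have := nrm_tri y (fproj k a y) z; have := nrm_tri (fproj k a y) (fproj k a z) z.
by rewrite (nrmBC (fproj k a z) z); lra.
Qed.

(** * Boundedness of complements *)

Lemma pow3_bound n : n.+1%:R <= 3 ^+ n :> R.
Proof. by rewrite -natrX ler_nat ltn_expl. Qed.

(* Gliding hump: each step moves by [3^-n], with the sign that makes the pairing with
   [z n] grow, so that all later steps together undo at most half of it. *)
Lemma uniform_boundedness X (W : set V) : clsub X -> (forall z, W z -> X z) ->
  (forall y, X y -> exists C : R, forall z, W z -> `|rip y z| <= C) ->
  exists M : R, forall z, W z -> nrm z <= M.
Proof.
move=> hX WX hb; apply: contrapT => hno; have hs := clsub_sub hX.
(* The size [2 n 3^n] is set against the step length [3^-n]: half of [3^-n |z n|] still exceeds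
   [n]. *)
have /choice[z hz] : forall n : nat, exists z, W z /\ 2 * n%:R * 3 ^+ n < nrm z.
  move=> n; apply: contrapT => h; apply: hno; exists (2 * n%:R * 3 ^+ n) => z wz.
  by rewrite leNgt; apply/negP => hlt; apply: h; exists z.
have z0 n : 0 < nrm (z n).
  by apply: le_lt_trans (proj2 (hz n)); rewrite !mulr_ge0 ?exprn_ge0 ?ler0n.
pose q n : R := (3 ^+ n)^-1.
have q0 n : 0 < q n by rewrite invr_gt0 exprn_gt0.
have qS n : q n.+1 = q n / 3 by rewrite /q exprS invfM mulrC.
pose sg (r : R) : R := if 0 <= r then 1 else -1.
pose st n (y : V) : V := y + (sg (rip y (z n)) * (q n / nrm (z n)))%:C *: z n.
pose y := fix y n := if n is n'.+1 then st n' (y n') else 0.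
have yS n : y n.+1 = st n (y n) by [].
have Xy n : X (y n).
  elim: n => [|n IH]; first by case: hs.
  by rewrite yS; apply: subspaceD => //; apply: subspaceZ => //; apply: WX; case: (hz n).
have sg1 r : `|sg r| = 1 by rewrite /sg; case: ifP; rewrite ?normrN normr1.
have step n : nrm (y n.+1 - y n) <= q n.
  rewrite yS /st addrC addKr nrmZr normrM sg1 mul1r ger0_norm ?divr_ge0 ?(ltW (q0 n)) ?nrm_ge0 //.
  by rewrite divfK // gt_eqF.
(* The right side is the geometric sum of the step lengths [q i] for [m <= i < d + m]. *)
have dist m d : nrm (y (d + m)%N - y m) <= 3 / 2 * q m - 3 / 2 * q (d + m)%N.
  elim: d => [|d IH]; first by rewrite subrr nrm0 subrr.
  have := nrm_tri (y (d.+1 + m)%N) (y (d + m)%N) (y m).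
  by have := step (d + m)%N; rewrite addSn qS; lra.
have dist' m n : (m <= n)%N -> nrm (y n - y m) <= 3 / 2 * q m.
  move=> mn; have := dist m (n - m)%N; rewrite subnK // => h.
  by apply: (le_trans h); have := q0 n; lra.
have [|l hl] := @complete y.
  move=> e e0; have [|N hN] := @invn_lt (e / 3); first by lra.
  exists N => m n hm hn.
  have qN : q N < e / 3.
    apply: le_lt_trans (hN N (leqnn N)).
    by rewrite lef_pV2 ?posrE ?ltr0n ?exprn_gt0 // pow3_bound.
  have := nrm_tri (y m) (y N) (y n); have := dist' _ _ hm; have := dist' _ _ hn.
  rewrite (nrmBC (y N) (y n)) => h1 h2 h3.
  suff : nrm (y m - y n) <= 3 * q N by lra.
  by lra.
have Xl : X l by case: hX => _ h; apply: (h y) => //; apply/hconvP.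
have hdist m : nrm (l - y m) <= 3 / 2 * q m.
  apply: le_eps => e e0; have [N hN] := hl e e0.
  have := hN _ (leq_maxl N m); have := dist' _ _ (leq_maxr N m).
  have := nrm_tri l (y (maxn N m)) (y m).
  by rewrite (nrmBC l (y (maxn N m))); lra.
have grow n : q n * nrm (z n) <= `|rip (y n.+1) (z n)|.
  rewrite yS /st ripDl ripZl -sqr_nrm; set r := rip (y n) (z n).
  have -> : sg r * (q n / nrm (z n)) * nrm (z n) ^+ 2 = sg r * (q n * nrm (z n)).
    by field; rewrite gt_eqF.
  have qz : 0 <= q n * nrm (z n) by rewrite mulr_ge0 ?(ltW (q0 n)) ?nrm_ge0.
  rewrite /sg; case: ifP => [r0|/negbT]; last rewrite -ltNge => r0.
    by rewrite mul1r ger0_norm; lra.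
  by rewrite mulN1r ltr0_norm; lra.
have [C hC] := hb l Xl.
(* The moves after step [n] total at most [3/2 q (n+1) = q n / 2], so
   [|<l, z n>| >= q n |z n| / 2 >= n], against the bound [C] at [l]. *)
have large n : n%:R <= C.
  have [wz nz] := hz n; apply: le_trans (hC _ wz).
  have := grow n; have := hdist n.+1; rewrite qS => h1 h2.
  have -> : rip l (z n) = rip (y n.+1) (z n) + rip (l - y n.+1) (z n) by rewrite -ripDl addrC subrK.
  have h3 : `|rip (l - y n.+1) (z n)| <= q n * nrm (z n) / 2.
    apply: le_trans (cauchy_schwarz_abs _ _) _.
    apply: le_trans (ler_wpM2r (nrm_ge0 _) h1) _; lra.
  have h4 : n%:R <= q n * nrm (z n) / 2.
    rewrite ler_pdivlMr // /q ler_pdivlMl ?exprn_gt0 //; apply: ltW.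
    by apply: le_lt_trans nz; rewrite le_eqVlt; apply/orP; left; apply/eqP; ring.
  have := lerB_normD (rip (y n.+1) (z n)) (rip (l - y n.+1) (z n)); lra.
have := archi_boundP (le_trans (ler0n R 0) (large 0%N)).
by rewrite ltNge large.
Qed.

(** The image of [X] is closed by the lower bound, and dense because a vector of [T] orthogonal to
    it is orthogonal to [X]. *)
Lemma oproj_bounded_below_onto X T (c : R) : clsub X -> clsub T -> 0 < c ->
  (forall x, X x -> c * nrm x <= nrm (P T x)) -> (forall t, T t -> orth ip X t -> t = 0) ->
  forall t, T t -> exists2 x, X x & P T x = t.
Proof.
move=> hX hT c0 hc h t tt.
have hl : lin_on X (P T) by apply: lin_onT; apply: oproj_lin.
have hI : clsub (P T @` X).
  apply: (@bounded_below_image_closed _ _ (clsub_sub hX) hl 1 c) => //.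
    by case: hX.
  by move=> x _; rewrite mul1r; apply: nrm_oproj.
suff [x Xx <-] : (P T @` X) t by exists x.
apply: closed_adh => //; apply: dense_criterion tt => //; first exact: clsub_sub.
  by move=> _ [x _ <-]; apply: oproj_in.
move=> y ty oy; apply: h => // x Xx.
by rewrite -(oproj_id hT ty) ip_oproj //; apply: oy; exists x.
Qed.

(** Uniform boundedness is applied to the [x] of [Z^perp] with [|P_T x| <= 1]: writing [y = t + z]
    gives [<y, x> = <t, P_T x>], which is bounded by [|t|]. *)
Lemma complement_bounded_below T Z : clsub T -> clsub Z -> (forall x, T x -> Z x -> x = 0) ->
  (forall x, exists t z, [/\ T t, Z z & x = t + z]) ->
  exists2 c : R, 0 < c & forall x, orth ip Z x -> c * nrm x <= nrm (P T x).
Proof.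
move=> hT hZ TZ0 TZ; have hX := orth_clsub Z.
have [|//|M hM] := @uniform_boundedness (orth ip Z) (fun x => orth ip Z x /\ nrm (P T x) <= 1) hX.
- by move=> z [].
- move=> y _; have [t [z [tt zz ->]]] := TZ y; exists (nrm t) => x [ox nx].
  rewrite ripDl (ip0_rip (orth_mem zz ox)) addr0 -(oproj_id hT tt) rip_oproj //.
  apply: le_trans (cauchy_schwarz_abs _ _) _; rewrite (oproj_id hT tt).
  by apply: ler_piMr => //; apply: nrm_ge0.
have M0 : 0 <= M.
  have o0 S : orth ip S 0 by move=> y _; exact: ip0l.
  by apply: le_trans (nrm_ge0 0) (hM 0 _); split=> //; rewrite oproj_0 // nrm0.
have M1 : 0 < M + 1 by lra.
exists (M + 1)^-1; first by rewrite invr_gt0.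
move=> x ox; rewrite ler_pdivrMl //.
set p := nrm (P T x); have p0 : 0 <= p by apply: nrm_ge0.
(* As [p] might be [0], [x] is rescaled by [p + d] instead; the choice of [d] turns the loss into
   [e]. *)
apply: le_eps => e e0; pose d := e / (M + 1).
have d0 : 0 < d by rewrite divr_gt0.
have pd : 0 < p + d by lra.
have := hM ((p + d)^-1%:C *: x) _; rewrite nrmZr ger0_norm ?invr_ge0 ?(ltW pd) //.
rewrite ler_pdivrMl // => h.
have : nrm x <= (p + d) * M.
  apply: h; split; first by apply: (subspaceZ _ (clsub_sub hX)).
  rewrite (@lin_onZ setT) //; last by apply: lin_onT; apply: oproj_lin.
  rewrite nrmZr ger0_norm ?invr_ge0 ?(ltW pd) // ler_pdivrMl // mulr1 -/p; lra.
have -> : e = d * (M + 1) by rewrite divfK // gt_eqF.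
by nra.
Qed.

(** With [s = P_S x], one has [|s|^2 = <P_X s, x> <= |P_X s| |x|] and [c |x| <= |s|]. *)
Lemma adjoint_bounded_below S X (c : R) : clsub S -> clsub X -> 0 < c ->
  (forall x, X x -> c * nrm x <= nrm (P S x)) -> (forall s, S s -> exists2 x, X x & P S x = s) ->
  forall s, S s -> c * nrm s <= nrm (P X s).
Proof.
move=> hS hX c0 hc onto s ss; have [x Xx xs] := onto s ss.
have [s0|s0] := pselect (s = 0); first by rewrite s0 nrm0 mulr0 nrm_ge0.
have n0 := nrm_gt0 s0; rewrite -(ler_pM2r n0).
have h : nrm s * nrm s <= nrm (P X s) * nrm x.
  rewrite -expr2 sqr_nrm -{2}xs -rip_oproj // (oproj_id hS ss).
  by rewrite -(oproj_id hX Xx) -rip_oproj // (oproj_id hX Xx) cauchy_schwarz.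
have := hc x Xx; rewrite xs => h2.
rewrite -mulrA; apply: le_trans (ler_wpM2l (ltW c0) h) _.
by rewrite mulrCA ler_wpM2l ?nrm_ge0.
Qed.

Lemma inverse_on S X J : is_subspace S -> is_subspace X -> lin_on S J -> (forall s, S s -> X (J s)) ->
  (forall x, X x -> exists2 s, S s & J s = x) -> (forall s, S s -> J s = 0 -> s = 0) ->
  exists Ji, [/\ forall x, X x -> S (Ji x), forall x, X x -> J (Ji x) = x,
    forall s, S s -> Ji (J s) = s & lin_on X Ji].
Proof.
move=> hS hX hJ JX onto inj.
have /choice[Ji hJi] : forall x, exists s, X x -> S s /\ J s = x.
  move=> x; have [Xx|nX] := pselect (X x); last by exists 0.
  by have [s ss e] := onto x Xx; exists s.
have h1 x : X x -> S (Ji x) by case/hJi.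
have h2 x : X x -> J (Ji x) = x by case/hJi.
have injJ s t : S s -> S t -> J s = J t -> s = t.
  move=> ss st e; apply/eqP; rewrite -subr_eq0; apply/eqP; apply: inj; first exact: subspaceB.
  by rewrite (lin_onB hS hJ) // e subrr.
exists Ji; split=> // [s ss|a x y Xx Xy]; first by apply: injJ; rewrite ?h2 //; [apply: h1|]; apply: JX.
have Xxy : X (a *: x + y) by case: hX => _; apply.
apply: injJ; [exact: h1 | by case: hS => _; apply; apply: h1 |].
by rewrite h2 // hJ ?h2 //; apply: h1.
Qed.

(** * Fredholm alternative *)

Section RieszChain.
Variables (H : set V) (K : V -> V) (C : R).
Hypotheses (hH : clsub H) (linK : lin_on H K) (KH : forall x, H x -> H (K x)).
Hypotheses (bK : forall x, H x -> nrm (K x) <= C * nrm x) (cK : ctb H K).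
Hypothesis injL : forall x, H x -> x - K x = 0 -> x = 0.

Let L x := x - K x.
Let hs : is_subspace H := clsub_sub hH.

Lemma one_minus_lin : lin_on H L.
Proof.
move=> a x y hx hy; rewrite /L linK // opprD addrACA.
by rewrite scalerBr.
Qed.

Lemma one_minus_bounded x : H x -> nrm (L x) <= (1 + C) * nrm x.
Proof. by move=> hx; have := nrmB x (K x); have := bK hx; rewrite /L; lra. Qed.

Lemma one_minus_in x : H x -> H (L x).
Proof. by move=> hx; apply: subspaceB => //; apply: KH. Qed.

(** Suppose unit vectors satisfy [L (u n) -> 0]. By compactness [u = L u + K u] converges along a
    subsequence; the limit is killed by [L], hence is [0], against unit length. *)
Lemma one_minus_bounded_below : exists2 c : R, 0 < c & forall x, H x -> c * nrm x <= nrm (L x).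
Proof.
apply: contrapT => hno.
have /choice[u hu] : forall n : nat, exists x, [/\ H x, nrm x = 1 & nrm (L x) < n.+1%:R^-1].
  move=> n; apply: contrapT => h; apply: hno; exists n.+1%:R^-1; first by rewrite invr_gt0 ltr0n.
  move=> x hx; rewrite leNgt; apply/negP => hlt; apply: h.
  have x0 : x <> 0 by move=> x0; move: hlt; rewrite x0 nrm0 mulr0 ltNge nrm_ge0.
  have n0 := nrm_gt0 x0; exists ((nrm x)^-1%:C *: x); split.
  - exact: subspaceZ.
  - exact: normalize.
  rewrite (lin_onZ hs one_minus_lin) // nrmZr ger0_norm ?invr_ge0 ?nrm_ge0 //.
  by rewrite mulrC ltr_pdivrMr.
have Hu n : H (u n) by case: (hu n).
have [|phi [hphi [l hl]]] := ctb_extract (u := u) (M := 1) cK Hu.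
  by move=> n; case: (hu n) => _ ->.
have hL0 : cvs (fun n => L (u (phi n))) 0.
  move=> e e0; have [N hN] := invn_lt e0; exists N => n hn; rewrite subr0.
  have [_ _ h] := hu (phi n); apply: lt_trans h (hN _ _).
  exact: leq_trans hn (incr_ge n hphi).
have hul : cvs (fun n => u (phi n)) l.
  have := cvsD hL0 hl; rewrite add0r.
  by rewrite (_ : (fun n => _) = (fun n => u (phi n))) //; apply: funext => n; rewrite subrK.
have Hl : H l by apply: closed_adh => //; apply: cvs_adh hul => n.
have l0 : l = 0.
  apply: injL => //; apply: cvs_unique _ hL0.
  apply: (cvs_lipschitz (f := L)) hul => n; rewrite -(lin_onB hs one_minus_lin) //.
  by apply: one_minus_bounded; apply: subspaceB.
have [N hN] := hul 1 ltr01; have := hN N (leqnn N).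
by rewrite l0 subr0; case: (hu (phi N)) => _ -> _; rewrite ltxx.
Qed.

Let chain := fix chain n : set V := if n is n'.+1 then L @` chain n' else H.

Lemma chain_sub n x : chain n x -> H x.
Proof. by elim: n x => // n IH _ [x /IH hx <-]; apply: one_minus_in. Qed.

Lemma chain_clsub n : clsub (chain n).
Proof.
elim: n => // n IH; have [c c0 hc] := one_minus_bounded_below.
apply: (@bounded_below_image_closed _ L (clsub_sub IH) _ (1 + C) c) => //.
- by move=> a x y /chain_sub hx /chain_sub hy; apply: one_minus_lin.
- by case: IH.
- by move=> x /chain_sub hx; apply: one_minus_bounded.
- by move=> x /chain_sub hx; apply: hc.
Qed.

Lemma chain_decr n x : chain n.+1 x -> chain n x.
Proof.
elim: n x => [|n IH] x; first exact: (@chain_sub 1).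
by case=> y /IH hy <-; exists y.
Qed.

Lemma chain_le m n x : (m <= n)%N -> chain n x -> chain m x.
Proof.
elim: n => [|n IH]; first by rewrite leqn0 => /eqP ->.
by rewrite leq_eqVlt => /orP[/eqP -> //|/IH h /chain_decr /h].
Qed.

(** If [y] is not attained, injectivity makes the chain of ranges of powers of [L] strictly
    decreasing, as [iter n L y] witnesses. Unit vectors of [chain n] orthogonal to [chain n.+1] then
    have images under [K] at mutual distance at least [1]. *)
Lemma fredholm_injective_surjective y : H y -> exists2 x, H x & x - K x = y.
Proof.
move=> hy; apply: contrapT => hno.
have inj x z : H x -> H z -> L x = L z -> x = z.
  move=> hx hz e; apply/eqP; rewrite -subr_eq0; apply/eqP/injL; first exact: subspaceB.
  by rewrite -/(L _) (lin_onB hs one_minus_lin) // e subrr.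
have hy' n : chain n (iter n L y) /\ ~ chain n.+1 (iter n L y).
  elim: n => [|n [IH1 IH2]]; first by split=> // -[x hx e]; apply: hno; exists x.
  split; first by exists (iter n L y).
  move=> [x hx e]; apply: IH2; rewrite -(inj x (iter n L y)) //.
    exact: (chain_sub (n := n.+1)).
  exact: (chain_sub (n := n)).
have /choice[u hu] : forall n, exists x, [/\ chain n x, nrm x = 1 & orth ip (chain n.+1) x].
  move=> n; have [h1 h2] := hy' n; have hc := chain_clsub n.+1.
  set z := iter n L y in h1 h2; pose w := z - P (chain n.+1) z.
  have w0 : w <> 0.
    by move/eqP; rewrite subr_eq0 => /eqP e; apply: h2; rewrite e; apply: oproj_in.
  have cw : chain n w.
    apply: subspaceB => //; first exact: clsub_sub (chain_clsub n).
    by apply: chain_decr; apply: oproj_in.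
  exists ((nrm w)^-1%:C *: w); split; last first.
  - by apply: (subspaceZ _ (orth_subspace _)); apply: oproj_orth.
  - exact: normalize.
  - by apply: subspaceZ => //; exact: clsub_sub (chain_clsub n).
have Hu n : H (u n) by case: (hu n) => /chain_sub.
apply: (@ctb_separated H K u 1 1 cK Hu) => // [n|i j ij]; first by case: (hu n) => _ ->.
(* [K (u i) - K (u j)] equals [u i - b], and [b] lies in [chain i.+1], to which [u i] is
   orthogonal. *)
pose b := L (u i) + u j - L (u j).
have cb : chain i.+1 b.
  have sc := clsub_sub (chain_clsub i.+1).
  apply: subspaceB => //; first apply: subspaceD => //.
  - by exists (u i) => //; case: (hu i).
  - by apply: (chain_le ij); case: (hu j).
  - by apply: (chain_le (leqW ij)); exists (u j) => //; case: (hu j).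
have -> : K (u i) - K (u j) = u i - b.
  by rewrite /b /L -addrA subKr opprD opprB addrA [u i + _]addrC subrK.
rewrite -(ler_pXn2r (n := 2)) ?nnegrE ?nrm_ge0 ?ler01 // sqr_nrm expr1n.
have [_ nu ou] := hu i; clearbody b.
rewrite ripBl !ripBr (ripC b (u i)) (ip0_rip (ou b cb)) -sqr_nrm nu.
by have := rip_ge0 b; lra.
Qed.

End RieszChain.

(* Add to [A] a finite rank operator embedding its kernel into the orthogonal complement [D] of
   its range: the sum is injective, hence onto, so the kernel has to fill [D]. *)
Lemma fredholm_dim_ge S X J A (D : set V) (c C : R) (a b : nat) : clsub S -> clsub X ->
  lin_on S J -> lin_on S A -> (forall s, S s -> X (J s)) -> (forall s, S s -> X (A s)) ->
  0 < c -> (forall s, S s -> c * nrm s <= nrm (J s)) -> (forall s, S s -> nrm (J s) <= C * nrm s) ->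
  (forall s, S s -> nrm (A s) <= C * nrm s) ->
  (forall x, X x -> exists2 s, S s & J s = x) -> ctb S (fun s => J s - A s) ->
  is_subspace D -> (forall d, D d -> X d) -> (forall s d, S s -> D d -> ip (A s) d = 0) ->
  has_dim (fun s => S s /\ A s = 0) a -> has_dim D b -> (b <= a)%N.
Proof.
move=> hS hX lJ lA JX AX c0 cJ CJ CA onto cK hD DX AD ha hb; rewrite leqNgt; apply/negP => ab.
have hs := clsub_sub hS; have hx := clsub_sub hX.
have [|k [ok sk pk]] := has_dim_orthonormal _ ha.
  split; first by split; [case: hs | apply: (lin_on0 hs lA)].
  move=> r x y [sx Ax] [sy Ay]; split; first by case: hs => _; apply.
  by rewrite lA // Ax Ay scaler0 addr0.
have [d [od sd pd]] := has_dim_orthonormal hD hb.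
have [|Ji [JiS JJi JiJ lJi]] := inverse_on hs hx lJ JX onto.
  move=> s ss Js; apply: nrm_eq0; apply/eqP; rewrite eq_le nrm_ge0 andbT -(ler_pM2l c0) mulr0.
  by apply: le_trans (cJ _ ss) _; rewrite Js nrm0.
(* [F] sends the orthonormal basis of the kernel of [A] to [d 0, .., d (a-1)]. As [a < b], the
   vector [d a] exists and is orthogonal to the range of [F]; it will be the value that cannot be
   attained. *)
pose F s := \sum_(i < a) ip s (k i) *: d i.
have lF : lin F.
  move=> r x y; rewrite /F scaler_sumr -big_split; apply: eq_bigr => i _ /=.
  by rewrite ipPl scalerDl scalerA.
have FD s : D (F s).
  by apply: subspace_sum => // i _; apply: subspaceZ => //; apply: sd; apply: ltn_trans ab.
have FX s : X (F s) by apply: DX.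
have ipF s j : (j < a)%N -> ip (F s) (d j) = ip s (k j).
  move=> ja; rewrite ip_suml (bigD1 (Ordinal ja)) //= ipZl od ?eqxx ?mulr1 ?(ltn_trans ja) //.
  rewrite big1 ?addr0 // => i; rewrite -val_eqE /= => ij.
  by rewrite ipZl od ?(negbTE ij) ?mulr0 ?(ltn_trans ja ab) // (ltn_trans _ ab).
have ipFa s : ip (F s) (d a) = 0.
  rewrite ip_suml big1 // => i _; have ib := ltn_trans (ltn_ord i) ab.
  by rewrite ipZl od // ltn_eqF ?mulr0.
(* With this choice [1 - J^-1 G = J^-1 (A + F)] on [S], and [J^-1 G] is the compact operator fed to
   the Fredholm alternative. *)
pose G s := J s - A s - F s.
have lG : lin_on S G.
  by move=> r x y sx sy; rewrite /G lJ // lA // lF (opprD (r *: A x)) (addrACA (r *: J x)) -scalerBr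
    (opprD (r *: F x)) addrACA -scalerBr.
have GX s : S s -> X (G s).
  by move=> ss; rewrite /G; do 2?apply: subspaceB => //; [apply: JX | apply: AX].
have cG : ctb S G.
  have := ctbD cK (@ctb_finite_rank S a k (fun i => - d i)).
  apply: ctb_ext => s ss; rewrite /G /F; congr (_ + _).
  by rewrite -sumrN; apply: eq_bigr => i _; rewrite scalerN.
have nJi x : X x -> nrm (Ji x) <= c^-1 * nrm x.
  by move=> Xx; rewrite ler_pdivlMl //; apply: le_trans (cJ _ (JiS _ Xx)) _; rewrite JJi.
have [CF hCF] : exists CF : R, forall s, nrm (F s) <= CF * nrm s.
  (* The factor [2] comes from bounding the real and imaginary parts of each coefficient
     separately. *)
  exists (\sum_(i < a) (2 * nrm (k i) * nrm (d i))) => s.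
  rewrite /F mulr_suml; elim/big_ind2: _ => [|x1 y1 x2 y2 h1 h2|i _]; first by rewrite nrm0.
    by apply: le_trans (nrmD _ _) _; apply: lerD.
  rewrite ip_split scalerDl -scalerA; apply: le_trans (nrmD _ _) _; rewrite !nrmZr.
  have ni x : nrm (i_ *: x) = nrm x by rewrite /nrm rip_normZ /= expr0n expr1n add0r mul1r.
  rewrite ni; have := cauchy_schwarz_abs s (k i); have := cauchy_schwarz_abs s (i_ *: k i).
  rewrite ni => h1 h2; rewrite -mulrDl.
  by have := ler_wpM2r (nrm_ge0 (d i)) (lerD h1 h2); lra.
have id_sub s : S s -> s - Ji (G s) = Ji (A s + F s).
  move=> ss; rewrite -{1}(JiJ s ss) -(lin_onB hx lJi) //; [|exact: JX|exact: GX].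
  by rewrite /G -addrA -opprD subKr.
have AFX s : S s -> X (A s + F s) by move=> ss; apply: subspaceD => //; apply: AX.
(* [A s] is orthogonal to [D], yet equals [z - F s], which lies in [D]. *)
have split0 s z : S s -> D z -> A s + F s = z -> A s = 0.
  move=> ss Dz e; apply: (@orth_self D); last by move=> w Dw; apply: AD.
  by have -> : A s = z - F s; [rewrite -e addrK | apply: subspaceB].
have surj := @fredholm_injective_surjective S (fun s => Ji (G s)) (c^-1 * (C + C + CF)) hS.
have [||||||s ss] := surj _ _ _ _ _ (Ji (d a)).
- by move=> r x y sx sy; rewrite lG // lJi //; apply: GX.
- by move=> s ss; apply: JiS; apply: GX.
- move=> s ss; apply: le_trans (nJi _ (GX _ ss)) _; rewrite -mulrA ler_wpM2l ?invr_ge0 ?(ltW c0) //.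
  have := nrmB (J s - A s) (F s); have := nrmB (J s) (A s).
  by have := hCF s; have := CJ s ss; have := CA s ss; rewrite /G; lra.
- apply: (@ctb_postcomp S X G Ji c^-1) => // x y Xx Xy.
  by rewrite -(lin_onB hx lJi) //; apply: nJi; apply: subspaceB.
- move=> s ss; rewrite id_sub // => h0.
  have e0 : A s + F s = 0 by rewrite -(JJi _ (AFX s ss)) h0 (lin_on0 hs lJ).
  have As : A s = 0 by apply: (split0 s 0) => //; case: hD.
  have Fs : F s = 0 by rewrite -e0 As add0r.
  rewrite -(pk s (conj ss As)) /fproj big1 // => i _.
  by rewrite -ipF // Fs ip0l scale0r.
- by apply: JiS; apply: DX; apply: sd.
rewrite id_sub // => e.
have Xda : X (d a) by apply: DX; apply: sd.
have e1 : A s + F s = d a by rewrite -(JJi _ (AFX s ss)) e JJi.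
have As : A s = 0 by apply: (split0 s (d a)) => //; apply: sd.
have : ip (d a) (d a) = 0 by rewrite -{1}e1 As add0r ipFa.
by rewrite od // eqxx => /eqP; rewrite oner_eq0.
Qed.

(** * Dimensions forced by compactness and a common complement *)

Lemma has_dim_image S f n : is_subspace S -> lin_on S f -> (forall x, S x -> f x = 0 -> x = 0) ->
  has_dim S n -> has_dim (f @` S) n.
Proof.
move=> hS lf inj [v [sv lv gv]]; exists (fun i => f (v i)); split=> [i|c hc|_ [x sx <-]].
- by exists (v i).
- apply: lv; apply: inj; last by rewrite (lin_on_sum hS lf).
  by apply: subspace_sum => // i _; apply: subspaceZ.
- by have [c ->] := gv x sx; exists c; rewrite (lin_on_sum hS lf).
Qed.

(** For [x] in [S], [|P_T x|^2 = <x, P_S P_T x>]. Applied to differences of terms, of norm at most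
    [2 M], this passes compactness from [P_S P_T] to its adjoint, [P_T] on [S]. *)
Lemma ctb_oproj_adjoint S T : clsub S -> clsub T ->
  ctb S (fun x => P S (P T x)) -> ctb S (P T).
Proof.
move=> hS hT h u M su hM e e0.
have M0 : 0 <= M by apply: le_trans (nrm_ge0 _) (hM 0%N).
have M1 : 0 < 2 * M + 1 by lra.
have [|phi [hp hphi]] := h u M su hM (e ^+ 2 / (2 * M + 1)).
  by rewrite divr_gt0 ?exprn_gt0.
exists phi; split=> // i j; apply: nrm_lt => //.
have := hphi i j; rewrite ltr_pdivlMr //.
have lT : lin_on setT (P T) by apply: lin_onT; apply: oproj_lin.
have lS : lin_on setT (P S) by apply: lin_onT; apply: oproj_lin.
rewrite -(lin_onB _ lS) // -(lin_onB _ lT) //.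
set x := u (phi i) - u (phi j) => hx.
have sx : S x by apply: subspaceB => //; apply: clsub_sub.
have nx : nrm x <= 2 * M by have := nrmB (u (phi i)) (u (phi j)); have := hM (phi i); have := hM (phi j); lra.
apply: le_lt_trans hx.
rewrite rip_oproj // (oproj_id hT (oproj_in _ hT)).
rewrite -{1}(oproj_id hS sx) rip_oproj //.
apply: le_trans (cauchy_schwarz _ _) _; rewrite mulrC ler_wpM2l ?nrm_ge0 //; lra.
Qed.

(** On the intersection the compact operator is the identity. *)
Lemma compact_finite_dim_meet S T : clsub S -> clsub T ->
  compact_op ip (fun x => P S (P T x)) -> finite_dim (setI2 S T).
Proof.
move=> hS hT hc; apply: compact_identity_finite_dim; first exact: setI2_clsub.
have := compact_ctb (S := setI2 S T) hc; apply: ctb_ext => x [sx tx].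
by rewrite (oproj_id hT tx) (oproj_id hS sx).
Qed.

(** Each inequality is one use of [fredholm_dim_ge]: for [P_S P_T] from [X] to [S], compared with
    the isomorphism [P_S], and for its adjoint [P_X P_T] from [S] to [X], compared with [P_X]. *)
Lemma no_common_complement S T a b : clsub S -> clsub T ->
  compact_op ip (fun x => P S (P (orth ip T) x)) ->
  has_dim (setI2 S (orth ip T)) a -> has_dim (setI2 (orth ip S) T) b ->
  common_complement ip S T -> a = b.
Proof.
move=> hS hT hc ha hb [Z [hZ SZ TZ SZs TZs]].
have hTo := orth_clsub T; have hX := orth_clsub Z; set X := orth ip Z in hX.
have bnd (U : set V) : clsub U -> (forall x, U x -> Z x -> x = 0) ->
    (forall x, exists t z, [/\ U t, Z z & x = t + z]) -> exists c : R, [/\ 0 < c,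
    forall x, X x -> c * nrm x <= nrm (P U x), forall s, U s -> c * nrm s <= nrm (P X s),
    forall s, U s -> exists2 x, X x & P U x = s & forall x, X x -> exists2 s, U s & P X s = x].
  move=> hU UZ UZs; have [c c0 h1] := complement_bounded_below hU hZ UZ UZs.
  have h2 : forall s, U s -> exists2 x, X x & P U x = s.
    apply: (oproj_bounded_below_onto hX hU c0 h1) => t ut ot.
    by apply: UZ => //; rewrite -(orth_orth hZ).
  have h3 := adjoint_bounded_below hU hX c0 h1 h2.
  exists c; split=> //; apply: (oproj_bounded_below_onto hU hX c0 h3) => x Xx ox.
  apply: nrm_eq0; apply/eqP; rewrite eq_le nrm_ge0 andbT -(ler_pM2l c0) mulr0.
  by apply: le_trans (h1 _ Xx) _; rewrite oproj_0 // nrm0.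
have [c [c0 cSX cXS ontoS ontoX]] := bnd S hS SZ SZs.
have [c' [c'0 cTX cXT ontoT _]] := bnd T hT TZ TZs.
have lP U W : clsub U -> lin_on W (P U) by move=> hU; apply: lin_onT; apply: oproj_lin.
have lPP U U' W : clsub U -> clsub U' -> lin_on W (fun x => P U (P U' x)).
  by move=> hU hU' r x y _ _; rewrite !oprojP.
have n1 U x : clsub U -> nrm (P U x) <= 1 * nrm x by move=> hU; rewrite mul1r nrm_oproj.
have n2 U U' x : clsub U -> clsub U' -> nrm (P U (P U' x)) <= 1 * nrm x.
  by move=> hU hU'; rewrite mul1r; apply: le_trans (nrm_oproj _ hU) (nrm_oproj _ hU').
(* [D] is both the kernel of [P_S P_T] on [X] and the orthogonal complement in [X] of the range of
   [P_X P_T] on [S]. The bijection [P_T] from [X] to [T] carries it onto the intersection of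
   [S^perp] and [T], whence its dimension [b]. *)
pose D : set V := fun x => X x /\ P S (P T x) = 0.
have injT x : X x -> P T x = 0 -> x = 0.
  move=> Xx h; apply: nrm_eq0; apply/eqP; rewrite eq_le nrm_ge0 andbT -(ler_pM2l c'0) mulr0.
  by apply: le_trans (cTX _ Xx) _; rewrite h nrm0.
have [g [gX Tg gT lg]] := inverse_on (clsub_sub hX) (clsub_sub hT) (lP T X hT)
  (fun x _ => oproj_in x hT) ontoT injT.
have hN : clsub (setI2 (orth ip S) T) by apply: setI2_clsub => //; apply: orth_clsub.
have hD : has_dim D b.
  have <- : g @` (setI2 (orth ip S) T) = D.
    apply/seteqP; split=> [_ [t [ot tt] <-]|x [Xx h]].
      by split; [apply: gX | rewrite Tg // oproj_0].
    exists (P T x); last exact: gT.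
    split; last exact: oproj_in.
    by rewrite -(kernel_oproj hS).
  apply: has_dim_image hb; first exact: clsub_sub.
    by move=> r x y [_ tx] [_ ty]; apply: lg.
  by move=> t [_ tt] g0; rewrite -(Tg t tt) g0 (lin_on0 (clsub_sub hX) (lP _ X _)).
(* [P_X] has kernel [Z], so it is injective on [T] and adds nothing to the kernel of [P_T] on
   [S]. *)
have hM : (fun s => S s /\ P X (P T s) = 0) = setI2 S (orth ip T).
  apply/seteqP; split=> s [ss h]; split=> //; last first.
    by rewrite (oproj_0 hT h) (lin_on0 (clsub_sub hX) (lP _ X _)).
  rewrite -(kernel_oproj hT); apply: TZ; first exact: oproj_in.
  by rewrite -(orth_orth hZ) -(kernel_oproj hX).
have DS : is_subspace D.
  split; first by split; [case: (clsub_sub hX) | rewrite !(lin_on0 (clsub_sub hX) (lP _ X _))].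
  move=> r x y [Xx hx] [Xy hy]; split; first by case: (clsub_sub hX) => _; apply.
  by rewrite !oprojP // hx hy scaler0 addr0.
have cT := compact_ctb (S := S) hc.
have diff U x : clsub U -> P U x - P U (P T x) = P U (P (orth ip T) x).
  by move=> hU; rewrite oprojC // (lin_onB (S := setT) _ (lP _ _ _)).
apply/eqP; rewrite eqn_leq; apply/andP; split.
  apply: (@fredholm_dim_ge X S (P S) (fun x => P S (P T x)) (setI2 S (orth ip T)) c 1 b a) => //.
  - by apply: lP.
  - by apply: lPP.
  - by move=> s _; apply: oproj_in.
  - by move=> s _; apply: oproj_in.
  - by move=> s _; apply: n1.
  - by move=> s _; apply: n2.
  - by have := compact_ctb (S := X) hc; apply: ctb_ext => x _; rewrite diff.
  - by apply: clsub_sub; apply: setI2_clsub.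
  - by move=> d [].
  - move=> s d _ [sd td]; rewrite ip_oproj // (oproj_id hS sd).
    by apply: orth_mem td; apply: oproj_in.
apply: (@fredholm_dim_ge S X (P X) (fun x => P X (P T x)) D c 1 a b) => //.
- by apply: lP.
- by apply: lPP.
- by move=> s _; apply: oproj_in.
- by move=> s _; apply: oproj_in.
- by move=> s _; apply: n1.
- by move=> s _; apply: n2.
(* The compact factor is now [P_{T^perp}] on [S], the adjoint of the operator in the hypothesis. *)
- apply: (@ctb_ext S (fun x => P X (P (orth ip T) x))); first by move=> x _; rewrite diff.
  apply: (@ctb_postcomp S setT (P (orth ip T)) (P X) 1) => //; last exact: ctb_oproj_adjoint.
  by move=> x y _ _; rewrite -(lin_onB (S := setT) _ (lP _ _ _)) //; apply: n1.
- by move=> d [].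
- move=> s d ss [Xd hd]; rewrite ip_oproj // (oproj_id hX Xd) ip_oproj //.
  by rewrite -(oproj_id hS ss) ip_oproj // hd ip0r.
- by rewrite hM.
Qed.

(** * Square roots and polar decomposition *)

Lemma rip_cvs_eq u l v k a b : cvs u l -> cvs v k -> (forall n, rip (u n) a = rip (v n) b) ->
  rip l a = rip k b.
Proof.
move=> hu hv h; apply/eqP; rewrite -subr_eq0 -normr_eq0 eq_le normr_ge0 andbT.
apply: le_eps => e e0; rewrite add0r.
pose c := nrm a + nrm b + 1.
have c0 : 0 < c by rewrite /c; have := nrm_ge0 a; have := nrm_ge0 b; lra.
have ec : 0 < e / c by rewrite divr_gt0.
have [N hN] := hu _ ec; have [N' hN'] := hv _ ec.
have := hN _ (leq_maxl N N'); have := hN' _ (leq_maxr N N').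
set n := maxn N N' => h2 h1.
have -> : rip l a - rip k b = rip (v n - k) b - rip (u n - l) a.
  by rewrite !ripBl h; ring.
have h3 := cauchy_schwarz_abs (v n - k) b; have h4 := cauchy_schwarz_abs (u n - l) a.
apply: le_trans (ler_normB _ _) _; apply: le_trans (lerD h3 h4) _.
have h5 : nrm (v n - k) * nrm b <= e / c * nrm b by rewrite ler_wpM2r ?nrm_ge0 // ltW.
have h6 : nrm (u n - l) * nrm a <= e / c * nrm a by rewrite ler_wpM2r ?nrm_ge0 // ltW.
apply: le_trans (lerD h5 h6) _; rewrite -mulrDr.
rewrite mulrAC ler_pdivrMr // ler_pM2l // /c; lra.
Qed.

Lemma rip_sym_ip_sym B : lin B -> (forall x y, rip (B x) y = rip x (B y)) ->
  forall x y, ip (B x) y = ip x (B y).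
Proof.
move=> lB h x y; rewrite !ip_split !h; congr (_ + _%:C * _).
by rewrite (@lin_onZ setT) //; apply: lin_onT.
Qed.

Lemma rip_eq_ip_eq S a b : is_subspace S -> (forall s, S s -> rip s a = rip s b) ->
  forall s, S s -> ip s a = ip s b.
Proof.
move=> hS h s ss; apply/eqP; rewrite -subr_eq0 -ipBr; apply/eqP; apply: ip_sym0.
apply: (rip0_orth hS) ss => z sz; rewrite ripC ripBr h //; lra.
Qed.

Section SquareRoot.
Variable (A : V -> V).
Hypotheses (lA : lin A) (nA : forall x, nrm (A x) <= nrm x).
Hypothesis symA : forall x y, rip (A x) y = rip x (A y).

(* The limit [L] of [Y n] satisfies [2 L = A + L^2], so that [1 - L] is a square root of [1 - A].
   The scalars [y n], the same iteration run at [1], majorize all the norms. *)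
Let Y := fix Y n := if n is n'.+1 then fun x => (2^-1)%:C *: (A x + Y n' (Y n' x)) else fun=> 0.
Let y := fix y n : R := if n is n'.+1 then (1 + y n' ^+ 2) / 2 else 0.

Let YS n x : Y n.+1 x = (2^-1)%:C *: (A x + Y n (Y n x)). Proof. by []. Qed.
Let yS n : y n.+1 = (1 + y n ^+ 2) / 2. Proof. by []. Qed.

Lemma sqrt_iter_scalar n : 0 <= y n <= 1.
Proof. by elim: n => [|n IH]; rewrite ?lexx ?ler01 // yS; nra. Qed.

Lemma sqrt_iter_lin n : lin (Y n).
Proof.
elim: n => [|n IH] a x z; first by rewrite /= scaler0 addr0.
by rewrite !YS lA !IH addrACA -(scalerDr a) (scalerDr _ (a *: _)) !scalerA (mulrC a).
Qed.

Let linT n : lin_on setT (Y n). Proof. exact: lin_onT (sqrt_iter_lin n). Qed.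

Lemma nrm_half x : nrm ((2^-1)%:C *: x) = nrm x / 2.
Proof. by rewrite nrmZr ger0_norm ?invr_ge0 // mulrC. Qed.

Lemma sqrt_iter_bound n x : nrm (Y n x) <= y n * nrm x.
Proof.
elim: n x => [|n IH] x; first by rewrite /= nrm0 mul0r.
rewrite YS yS nrm_half; have := nrmD (A x) (Y n (Y n x)).
have h1 := IH (Y n x); have h2 := IH x; have h3 := nA x; have := sqrt_iter_scalar n => /andP[h4 _].
have := ler_wpM2l h4 h2; lra.
Qed.

Lemma sqrt_iter_sym n x z : rip (Y n x) z = rip x (Y n z).
Proof.
elim: n x z => [|n IH] x z; first by rewrite /= rip0l rip0r.
by rewrite !YS ripZl ripZr ripDl ripDr symA !IH.
Qed.

(** With [Y' = Y n.+1], the difference of squares is split as [Y' (Y' - Y) + (Y' - Y) Y]. The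
    resulting bound matches the scalar identity [y'' - y' = (y'^2 - y^2) / 2]. *)
Lemma sqrt_iter_step n x : nrm (Y n.+1 x - Y n x) <= (y n.+1 - y n) * nrm x.
Proof.
elim: n x => [|n IH] x.
  rewrite YS /= !subr0 addr0 nrm_half; have := nA x; lra.
rewrite YS [Y n.+1 x in X in nrm (_ - X)]YS -scalerBr opprD addrACA subrr add0r nrm_half.
have -> : Y n.+1 (Y n.+1 x) - Y n (Y n x) =
    Y n.+1 (Y n.+1 x - Y n x) + (Y n.+1 (Y n x) - Y n (Y n x)).
  by rewrite (lin_onB _ (linT n.+1)) // addrA subrK.
have := nrmD (Y n.+1 (Y n.+1 x - Y n x)) (Y n.+1 (Y n x) - Y n (Y n x)).
have h1 := sqrt_iter_bound n.+1 (Y n.+1 x - Y n x).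
have h2 := IH (Y n x); have h3 := sqrt_iter_bound n x; have h4 := IH x.
have /andP[y0 y1] := sqrt_iter_scalar n; have /andP[z0 z1] := sqrt_iter_scalar n.+1.
have d0 : 0 <= y n.+1 - y n by rewrite yS; nra.
have h5 := ler_wpM2l z0 h4; have h6 := ler_wpM2l d0 h3.
rewrite (yS n.+1) => h7.
apply: le_trans (_ : (y n.+1 * ((y n.+1 - y n) * nrm x) + (y n.+1 - y n) * (y n * nrm x)) / 2 <= _).
  by lra.
rewrite [X in _ <= (_ - X) * _]yS; move: (y n.+1) (y n) (nrm x) => p q r.
by rewrite le_eqVlt; apply/orP; left; apply/eqP; field.
Qed.

Lemma sqrt_iter_dist n d x : nrm (Y (d + n)%N x - Y n x) <= (y (d + n)%N - y n) * nrm x.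
Proof.
elim: d => [|d IH]; first by rewrite !subrr nrm0 mul0r.
have := nrm_tri (Y (d.+1 + n)%N x) (Y (d + n)%N x) (Y n x).
by have := sqrt_iter_step (d + n) x; rewrite addSn; lra.
Qed.

Lemma sqrt_iter_cvs x : exists l, cvs (fun n => Y n x) l.
Proof.
apply: complete => e e0; pose E : set R := fun r => exists n, r = y n.
have hE : has_sup E.
  split; first by exists (y 0), 0%N.
  by exists 1 => _ [n ->]; have /andP[] := sqrt_iter_scalar n.
pose c := 2 * nrm x + 1; have c0 : 0 < c by rewrite /c; have := nrm_ge0 x; lra.
(* A scalar [y N] within [e / c] of the supremum controls all later moves of the iterates. *)
have [|_ [N ->] hN] := @sup_adherent _ E (e / c) _ hE; first by rewrite divr_gt0.
have near n : (N <= n)%N -> nrm (Y n x - Y N x) <= e / c * nrm x.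
  move=> hn; have := sqrt_iter_dist N (n - N) x; rewrite subnK // => h.
  apply: le_trans h _; rewrite ler_wpM2r ?nrm_ge0 //.
  have : y n <= sup E by apply: ub_le_sup; [case: hE | exists n].
  by move: hN; lra.
exists N => m n /near hm /near hn; have := nrm_tri (Y m x) (Y N x) (Y n x).
rewrite (nrmBC (Y N x)) => h; apply: le_lt_trans h _; apply: le_lt_trans (lerD hm hn) _.
rewrite -mulr2n -mulr_natl mulrCA mulrAC ltr_pdivrMr // ltr_pM2l // /c; lra.
Qed.

(** [B = 1 - L] works: [1 - 2 L + L^2 = 1 - A], positivity holds because [L] is a contraction, and
    closed subspaces invariant under [A] are preserved by every iterate, hence by the limit. *)
Lemma operator_square_root : exists B, [/\ lin B, forall x z, ip (B x) z = ip x (B z),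
  forall x, 0 <= rip (B x) x, forall x, B (B x) = x - A x &
  forall S, clsub S -> (forall x, S x -> S (A x)) -> forall x, S x -> S (B x)].
Proof.
have /choice[L hL] := sqrt_iter_cvs.
have lL : lin L.
  move=> a x z; apply: (cvs_unique (hL (a *: x + z))).
  have -> : (fun n => Y n (a *: x + z)) = (fun n => a *: Y n x + Y n z).
    by apply: funext => n; rewrite sqrt_iter_lin.
  apply: cvsD => //.
  apply: (@cvs_lipschitz (fun x => a *: x) (Num.sqrt (complex.Re a ^+ 2 + complex.Im a ^+ 2))) => // n.
  apply: rip_le_sqr; first exact: sqrtr_ge0.
  by rewrite -scalerBr rip_normZ sqr_sqrtr // addr_ge0 ?sqr_ge0.
have linL : lin_on setT L by apply: lin_onT.
have Y1 n x : nrm (Y n x) <= nrm x.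
  have /andP[_ y1] := sqrt_iter_scalar n; apply: le_trans (sqrt_iter_bound n x) _.
  by rewrite ler_piMl ?nrm_ge0.
have nL x : nrm (L x) <= nrm x.
  apply: le_eps => e /(hL x)[N hN]; have := hN N (leqnn N); have := Y1 N x.
  by have := nrmB (Y N x) (Y N x - L x); rewrite subKr; lra.
have symL x z : rip (L x) z = rip x (L z).
  rewrite (ripC x); apply: (rip_cvs_eq (hL x) (hL z)) => n.
  by rewrite sqrt_iter_sym ripC.
have cYY x : cvs (fun n => Y n (Y n x)) (L (L x)).
  move=> e e0; have e2 : 0 < e / 2 by lra.
  have [N hN] := hL x _ e2; have [N' hN'] := hL (L x) _ e2.
  exists (maxn N N') => n; rewrite geq_max => /andP[/hN h1 /hN' h2].
  have := nrm_tri (Y n (Y n x)) (Y n (L x)) (L (L x)).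
  by have := Y1 n (Y n x - L x); rewrite (lin_onB _ (linT n)) //; lra.
have fixL x : L x + L x = A x + L (L x).
  have c1 : cvs (fun n => Y n.+1 x) (L x) by apply: (cvs_subseq (phi := S)) (hL x).
  have cA : cvs (fun=> A x) (A x) by move=> e e0; exists 0%N => n _; rewrite subrr nrm0.
  have c2 : cvs (fun n => A x + Y n (Y n x)) (A x + L (L x)) by apply: cvsD.
  apply: cvs_unique c2; have := cvsD c1 c1; congr cvs; apply: funext => n.
  by rewrite YS -scalerDr scale_half.
exists (fun x => x - L x); split.
- by move=> a x z; rewrite lL opprD addrACA -scalerBr.
- have l1 : lin (fun x => x - L x) by move=> a x z; rewrite lL opprD addrACA -scalerBr.
  by apply: rip_sym_ip_sym => // x z; rewrite ripBl ripBr symL.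
- move=> x; rewrite ripBl subr_ge0; apply: le_trans (cauchy_schwarz _ _) _.
  by rewrite -sqr_nrm expr2 ler_wpM2r ?nrm_ge0.
- move=> x; have -> : A x = L x + L x - L (L x) by rewrite fixL addrK.
  by rewrite (lin_onB _ linL) // opprB -addrA; congr (x + _); rewrite opprB opprD addrCA.
- move=> S hS SA x sx; have hs := clsub_sub hS; apply: subspaceB => //.
  apply: closed_adh => //; apply: cvs_adh (hL x) => n.
  elim: n x sx => [|n IH] x sx; first by case: hs.
  by rewrite YS; apply: subspaceZ => //; apply: subspaceD => //; [apply: SA | exact: (IH _ (IH _ sx))].
Qed.

End SquareRoot.

Definition part_orth (S K : set V) : set V := setI2 S (orth ip K).

(* Polar decomposition [P T = U B] of the restriction of [P T] to [S]. *)
Lemma polar_decomposition S T : clsub S -> clsub T -> exists B U : V -> V,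
  let S0 := part_orth S (setI2 S (orth ip T)) in
  let T0 := part_orth T (setI2 (orth ip S) T) in
  [/\ [/\ lin B, forall x z, ip (B x) z = ip x (B z), forall x, 0 <= rip (B x) x,
      forall s, S s -> rip (B s) (B s) = rip (P T s) (P T s) & forall s, S s -> S (B s)],
    lin_on S0 U, forall x, S0 x -> T0 (U x),
    (forall x z, S0 x -> S0 z -> ip (U x) (U z) = ip x z) /\ (forall t, T0 t -> exists2 x, S0 x & U x = t) &
    forall s x, S s -> S0 x -> ip s (U x) = ip s (B x)].
Proof.
move=> hS hT; have hs := clsub_sub hS; have ht := clsub_sub hT; have hTo := orth_clsub T.
have lP W : clsub W -> lin_on setT (P W) by move=> hW; apply: lin_onT; apply: oproj_lin.
(* On [S], [1 - A] is [P_S P_T], so [B] squares to [P_S P_T] there and [|B s| = |P_T s|]. *)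
have [|||B [lB symB posB sqB invB]] := @operator_square_root (fun x => P S (P (orth ip T) (P S x))).
- by move=> a x z; rewrite !oprojP.
- move=> x; apply: le_trans (nrm_oproj _ hS) _; apply: le_trans (nrm_oproj _ hTo) _.
  exact: nrm_oproj.
- by move=> x z; rewrite !rip_oproj.
have linB : lin_on setT B by apply: lin_onT.
have SB : forall s, S s -> S (B s) by apply: invB => // x _; apply: oproj_in.
have rsymB x z : rip (B x) z = rip x (B z) by rewrite /rip symB.
have BB s : S s -> B (B s) = P S (P T s).
  move=> ss; rewrite sqB (oproj_id hS ss) oprojC // (lin_onB _ (lP _ hS)) // (oproj_id hS ss).
  by rewrite subKr.
have nB s : S s -> rip (B s) (B s) = rip (P T s) (P T s).
  move=> ss; rewrite rsymB BB // -rip_oproj // (oproj_id hS ss) -rip_oproj //.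
  by rewrite [RHS]rip_oproj // (oproj_id hT (oproj_in s hT)) ripC.
have nB' s : S s -> nrm (B s) = nrm (P T s) by move=> ss; rewrite /nrm nB.
exists B; set K := setI2 S (orth ip T); set N := setI2 (orth ip S) T; rewrite /=.
set S0 := part_orth S K; set T0 := part_orth T N.
have hS0 : clsub S0 by apply: setI2_clsub => //; apply: orth_clsub.
have hT0 : clsub T0 by apply: setI2_clsub => //; apply: orth_clsub.
have KB x : K x -> B x = 0.
  by move=> [sx ox]; apply: nrm_eq0; rewrite nB' // oproj_0 // nrm0.
have BK s : S s -> B s = 0 -> K s.
  move=> ss Bs; split=> //; rewrite -(kernel_oproj hT); apply: nrm_eq0.
  by rewrite -nB' // Bs nrm0.
have BS0 s : S s -> S0 (B s).
  by move=> ss; split; [apply: SB | move=> k /KB Bk; rewrite symB Bk ip0r].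
have PT0 s : S s -> T0 (P T s).
  move=> ss; split; first exact: oproj_in.
  by move=> k [ok kt]; rewrite ip_oprojl //; apply: orth_mem ok.
(* The closure of the pairs [(B s, P_T s)] is the graph of [U]; taking one sequence for both limits
   preserves the equality of norms. *)
pose G x z := exists u : nat -> V, [/\ forall n, S (u n), cvs (fun n => B (u n)) x & cvs (fun n => P T (u n)) z].
have cZ (a : R[i]) u l : cvs u l -> cvs (fun n => a *: u n) (a *: l).
  move=> hu; apply: (@cvs_lipschitz (fun x => a *: x) (Num.sqrt (complex.Re a ^+ 2 + complex.Im a ^+ 2))) => // n.
  apply: rip_le_sqr; first exact: sqrtr_ge0.
  by rewrite -scalerBr rip_normZ sqr_sqrtr // addr_ge0 ?sqr_ge0.
have Glin a x z x' z' : G x z -> G x' z' -> G (a *: x + x') (a *: z + z').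
  move=> [u [su ux uz]] [v [sv vx vz]]; exists (fun n => a *: u n + v n); split.
  - by move=> n; case: hs => _; apply.
  - have -> : (fun n => B (a *: u n + v n)) = (fun n => a *: B (u n) + B (v n)).
      by apply: funext => n; apply: lB.
    by apply: cvsD => //; apply: cZ.
  - have -> : (fun n => P T (a *: u n + v n)) = (fun n => a *: P T (u n) + P T (v n)).
      by apply: funext => n; apply: oprojP.
    by apply: cvsD => //; apply: cZ.
have lim_le u l v k : cvs u l -> cvs v k -> (forall n, nrm (u n) = nrm (v n)) -> nrm l <= nrm k.
  move=> hu hv e; apply: le_eps => d d0; have d2 : 0 < d / 2 by lra.
  have [n1 h1] := hu _ d2; have [n2 h2] := hv _ d2.
  have := h1 _ (leq_maxl n1 n2); have := h2 _ (leq_maxr n1 n2); have := e (maxn n1 n2).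
  set n := maxn n1 n2 => e1 h3 h4.
  have := nrmB (u n) (u n - l); have := nrmD (v n - k) k; rewrite subKr subrK; lra.
have Gn x z : G x z -> nrm x = nrm z.
  move=> [u [su ux uz]]; apply/eqP; rewrite eq_le.
  by rewrite (lim_le _ _ _ _ ux uz) ?(lim_le _ _ _ _ uz ux) // => n; rewrite nB'.
have GT0 x z : G x z -> T0 z.
  by move=> [u [su ux uz]]; apply: closed_adh => //; apply: cvs_adh uz => n; apply: PT0.
have GS0 x z : G x z -> S0 x.
  by move=> [u [su ux uz]]; apply: closed_adh => //; apply: cvs_adh ux => n; apply: BS0.
have Gip x z : G x z -> forall s, S s -> ip s z = ip s (B x).
  move=> [u [su ux uz]]; apply: rip_eq_ip_eq => // s ss.
  rewrite -rsymB (ripC s) (ripC (B s)); apply: (rip_cvs_eq uz ux) => n.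
  by rewrite -rsymB BB // [RHS]rip_oproj // (oproj_id hS ss).
(* [B] maps [S] densely into [S0], since a vector of [S] orthogonal to the image is killed by [B]
   and so lies in [K]. If [B (u n)] converges, [P T (u n)] is Cauchy, its differences having the
   same norms. *)
have Gex x : S0 x -> exists z, G x z.
  move=> S0x; have [|u' hu cu] := @adh_seq (B @` S) x.
    apply: dense_criterion S0x => //.
    - by apply: (lin_on_image hs); apply: lin_onT.
    - by move=> _ [s ss <-]; apply: BS0.
    - move=> y [sy oy] ory; have By : B y = 0.
        apply: (@orth_self S); first exact: SB.
        by move=> s ss; rewrite symB; apply: ory; exists s.
      by apply: (orth_self (S := K)) => //; apply: BK.
  have /choice[u hu'] : forall n, exists s, S s /\ B s = u' n.
    by move=> n; have [s ss e] := hu n; exists s.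
  have su n : S (u n) by case: (hu' n).
  have eu : u' = fun n => B (u n) by apply: funext => n; case: (hu' n).
  rewrite eu in cu; have [|z hz] := @complete (fun n => P T (u n)); last by exists z, u.
  move=> e /(cvs_cauchy cu)[m hm]; exists m => i j hi hj.
  rewrite -(lin_onB _ (lP _ hT)) // -nB'; last exact: subspaceB.
  by rewrite (lin_onB _ linB) //; apply: hm.
have Gonto t : T0 t -> exists x, G x t.
  move=> T0t; have [|u' hu cu] := @adh_seq (P T @` S) t.
    apply: dense_criterion T0t => //.
    - by apply: (lin_on_image hs); apply: lin_onT; apply: oproj_lin.
    - by move=> _ [s ss <-]; apply: PT0.
    - move=> y [ty oy] ory; apply: (orth_self (S := N)) => //; split=> // s ss.
      by rewrite -(oproj_id hT ty) ip_oproj //; apply: ory; exists s.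
  have /choice[u hu'] : forall n, exists s, S s /\ P T s = u' n.
    by move=> n; have [s ss e] := hu n; exists s.
  have su n : S (u n) by case: (hu' n).
  have eu : u' = fun n => P T (u n) by apply: funext => n; case: (hu' n).
  rewrite eu in cu; have [|z hz] := @complete (fun n => B (u n)); last by exists z, u.
  move=> e /(cvs_cauchy cu)[m hm]; exists m => i j hi hj.
  rewrite -(lin_onB _ linB) // nB'; last exact: subspaceB.
  by rewrite (lin_onB _ (lP _ hT)) //; apply: hm.
have Guniq x z z' : G x z -> G x z' -> z = z'.
  move=> g g'; have := Glin (-1) _ _ _ _ g g'; rewrite !scaleN1r addNr => /Gn.
  by rewrite nrm0 => /esym/nrm_eq0/eqP; rewrite addrC subr_eq0 => /eqP.
have /choice[U hU] : forall x, exists z, S0 x -> G x z.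
  move=> x; have [/Gex[z hz]|h] := pselect (S0 x); last by exists 0.
  by exists z.
have lU : lin_on S0 U.
  move=> a x z hx hz; apply: Guniq (hU _ _) _; last by apply: Glin; apply: hU.
  by case: (clsub_sub hS0) => _; apply.
have nU x : S0 x -> rip (U x) (U x) = rip x x by move=> /hU/Gn e; rewrite -!sqr_nrm e.
have hs0 := clsub_sub hS0.
(* Norm preservation polarizes to the real inner product; testing against [i z] below gives the
   complex one. *)
have rU x z : S0 x -> S0 z -> rip (U x) (U z) = rip x z.
  move=> hx hz; have := nU _ (subspaceD hs0 hx hz).
  by rewrite (lin_onD lU) // !ripDl !ripDr !nU // (ripC (U z)) (ripC z); lra.
exists U; split=> //.
- by move=> x /hU/GT0.
- split; last first.
    by move=> t /Gonto[x hx]; have S0x := GS0 _ _ hx; exists x => //; apply: Guniq hx; apply: hU.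
  move=> x z hx hz; rewrite !ip_split rU //; congr (_ + _%:C * _).
  by rewrite -(lin_onZ hs0 lU) // rU //; apply: subspaceZ.
- by move=> s x ss /hU/Gip; apply.
Qed.

(** * Construction of common complements *)

Lemma orth_adh D x : is_subspace D -> orth ip D x -> orth ip (adh D) x.
Proof. by move=> hD ox; apply: rip0_orth (adh_subspace hD) _ => z hz; apply: orth_rip_adh hz. Qed.

(** With [X] the closure of the sums [x + y], [(1 - beta) |x|^2 <= <x, x + y> = <P_X x, x + y> <= 2
    |P_X x| |x|]. Hence [P_X] is bounded below on [S] by [c = (1 - beta) / 2]. It is also onto [X],
    so [Z = X^perp] complements [S]. *)
Lemma graph_half_complement S (G : V -> V -> Prop) (beta : R) : clsub S -> beta < 1 ->
  G 0 0 -> (forall a x y x' y', G x y -> G x' y' -> G (a *: x + x') (a *: y + y')) ->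
  (forall x y, G x y -> S x) -> (forall x y, G x y -> nrm x = nrm y) ->
  (forall x y, G x y -> - beta * rip x x <= rip x y) ->
  (forall s, S s -> adh (fun x => exists y, G x y) s) ->
  let Z := orth ip (fun w => exists x y, G x y /\ w = x + y) in
  (forall x, S x -> Z x -> x = 0) /\ (forall x, exists s z, [/\ S s, Z z & x = s + z]).
Proof.
move=> hS b1 G0 Glin GS Gn Gi Gd Z; set D : set V := fun w => _ in Z *.
have hD : is_subspace D.
  split; first by exists 0, 0; rewrite addr0.
  move=> a _ _ [x [y [g ->]]] [x' [y' [g' ->]]]; exists (a *: x + x'), (a *: y + y').
  by split; [apply: Glin | rewrite scalerDr addrACA].
have hX := adh_closed_subspace hD; have hZ := orth_clsub D.
pose c := (1 - beta) / 2; have c0 : 0 < c by rewrite /c; lra.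
have G1 x y : G x y -> (1 - beta) * rip x x <= rip x (x + y).
  by move=> /Gi h; rewrite ripDr; lra.
have cG x y : G x y -> c * nrm x <= nrm (P (adh D) x).
  move=> g; have [x0|x0] := pselect (x = 0); first by rewrite x0 nrm0 mulr0 nrm_ge0.
  have n0 := nrm_gt0 x0; rewrite -(ler_pM2r n0).
  have := G1 x y g; have hw : adh D (x + y) by apply: sub_adh; exists x, y.
  rewrite -(oproj_id hX hw) -rip_oproj // => h.
  have := cauchy_schwarz (P (adh D) x) (x + y); have := nrmD x y; rewrite -(Gn x y g) => h1 h2.
  have h3 := ler_wpM2l (nrm_ge0 (P (adh D) x)) h1.
  rewrite -sqr_nrm in h; rewrite /c; nra.
have cS s : S s -> c * nrm s <= nrm (P (adh D) s).
  move=> /Gd ds; apply: le_eps => e e0; have c1 : 0 < 1 + c by lra.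
  have [|x [y g] hx] := ds (e / (1 + c)); first by rewrite divr_gt0.
  move: hx; rewrite ltr_pdivlMr // => hx; have := cG x y g.
  have h1 : nrm s <= nrm x + nrm (s - x) by have := nrmD x (s - x); rewrite addrC subrK.
  have h2 : nrm (P (adh D) x) <= nrm (P (adh D) s) + nrm (s - x).
    have := nrmB (P (adh D) s) (P (adh D) s - P (adh D) x); rewrite subKr.
    rewrite -(lin_onB (S := setT)) //; last by apply: lin_onT; apply: oproj_lin.
    by have := nrm_oproj (s - x) hX; lra.
  have h3 := ler_wpM2l (ltW c0) h1; lra.
have ZX z : orth ip (adh D) z <-> Z z.
  split; last exact: orth_adh.
  by move=> h w dw; apply: h; apply: sub_adh.
split.
  move=> s ss /ZX oz; apply: nrm_eq0; apply/eqP; rewrite eq_le nrm_ge0 andbT -(ler_pM2l c0) mulr0.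
  by apply: le_trans (cS _ ss) _; rewrite oproj_0 // nrm0.
move=> v; have [|s ss e] := oproj_bounded_below_onto hS hX c0 cS _ (oproj_in v hX).
  (* Approximate [t] by [x + y]. As [<x, t> = 0], the lower bound on [<x, x + y>] makes [|x|] small,
     hence also [|y|] and [|t|]; [1 + c^-1] is the accumulated factor. *)
  move=> t ht ot; apply: nrm_eq0; apply/eqP; rewrite eq_le nrm_ge0 andbT.
  apply: le_eps => e e0; rewrite add0r.
  have k0 : 0 < 1 + c^-1 by have : 0 < c^-1 by [rewrite invr_gt0]; lra.
  have [|_ [x [y [g ->]]] hw] := ht (e / (1 + c^-1)); first by rewrite divr_gt0.
  move: hw; rewrite ltr_pdivlMr // => hw.
  have xt : rip x t = 0 by rewrite ripC; apply: ip0_rip; apply: ot; apply: GS g.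
  have h1 : c * nrm x <= nrm (t - (x + y)) / 2.
    have [x0|x0] := pselect (x = 0); first by rewrite x0 nrm0 mulr0 divr_ge0 ?nrm_ge0.
    have n0 := nrm_gt0 x0; rewrite -(ler_pM2r n0).
    have := G1 x y g; have := cauchy_schwarzN x (t - (x + y)).
    by rewrite ripBr xt -(sqr_nrm x) /c; nra.
  have h2 : nrm x <= c^-1 * (nrm (t - (x + y)) / 2) by rewrite ler_pdivlMl.
  have := nrmD (t - (x + y)) (x + y); rewrite subrK; have := nrmD x y; rewrite -(Gn _ _ g).
  lra.
exists s, (v - s); split=> //; last by rewrite addrC subrK.
apply/ZX; rewrite -(kernel_oproj hX) /kernel.
by rewrite (lin_onB (S := setT)) ?e ?subrr //; apply: lin_onT; apply: oproj_lin.
Qed.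

(** The half statement applies to [G] and to its converse, because [|x| = |y|] on [G], and both give
    the same complement. *)
Lemma graph_common_complement S T (G : V -> V -> Prop) (beta : R) : clsub S -> clsub T ->
  beta < 1 -> G 0 0 -> (forall a x y x' y', G x y -> G x' y' -> G (a *: x + x') (a *: y + y')) ->
  (forall x y, G x y -> S x /\ T y) -> (forall x y, G x y -> nrm x = nrm y) ->
  (forall x y, G x y -> - beta * rip x x <= rip x y) ->
  (forall s, S s -> adh (fun x => exists y, G x y) s) ->
  (forall t, T t -> adh (fun y => exists x, G x y) t) -> common_complement ip S T.
Proof.
move=> hS hT b1 G0 Glin GST Gn Gi GdS GdT.
have [|h1 h2] := @graph_half_complement S G beta hS b1 G0 Glin _ Gn Gi GdS.
  by move=> x y /GST[].
have [||||h3 h4] := @graph_half_complement T (fun y x => G x y) beta hT b1 G0 _ _ _ _ GdT.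
- by move=> a x y x' y' g g'; apply: Glin.
- by move=> x y /GST[].
- by move=> x y /Gn.
- by move=> x y g; rewrite ripC -!sqr_nrm -(Gn _ _ g) sqr_nrm; apply: Gi.
pose D : set V := fun w => exists x y, G x y /\ w = x + y.
have eD : (fun w => exists y x, G x y /\ w = y + x) = D.
  by apply/seteqP; split=> w [x [y [g ->]]]; exists y, x; rewrite addrC.
rewrite /= eD in h3 h4; exists (orth ip D); split=> //; exact: orth_clsub.
Qed.

(* [Q p q v] says that the isometry under construction sends [p] to [q], where [q] is [U v] up to
   a vector orthogonal to [S]. On the orthogonal complement of the domain of [Q] the isometry is [U]. *)
Lemma glue_common_complement S T B U (Q : V -> V -> V -> Prop) (beta : R) :
  let K := setI2 S (orth ip T) in let N := setI2 (orth ip S) T in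
  let S0 := part_orth S K in let T0 := part_orth T N in
  let M0 := fun p => exists q v, Q p q v in let N0 := fun q => exists p v, Q p q v in
  clsub S -> clsub T -> 0 <= beta < 1 ->
  lin B -> (forall x z, ip (B x) z = ip x (B z)) -> (forall x, 0 <= rip (B x) x) ->
  lin_on S0 U -> (forall x, S0 x -> T0 (U x)) ->
  (forall x z, S0 x -> S0 z -> ip (U x) (U z) = ip x z) ->
  (forall t, T0 t -> exists2 x, S0 x & U x = t) ->
  (forall s x, S s -> S0 x -> ip s (U x) = ip s (B x)) ->
  Q 0 0 0 -> (forall a p q v p' q' v', Q p q v -> Q p' q' v' ->
    Q (a *: p + p') (a *: q + q') (a *: v + v')) ->
  (forall p q v, Q p q v -> [/\ S p, T q, S v, nrm p = nrm q & nrm v <= nrm p]) ->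
  (forall p q v s, Q p q v -> S s -> ip s q = ip s (B v)) ->
  (forall p q v, Q p q v -> rip (p - v) (B (p - v)) <= beta * rip (p - v) (p - v)) ->
  (forall x, K x -> M0 x) -> (forall x, N x -> N0 x) ->
  (forall r, S0 r -> (orth ip M0 r <-> orth ip N0 (U r))) ->
  common_complement ip S T.
Proof.
move=> K N S0 T0 M0 N0 hS hT /andP[b0 b1] lB symB posB lU UT0 ipU ontoU Uip Q0 Qlin Qst Qip Qb KM NN hr.
have hs := clsub_sub hS; have ht := clsub_sub hT.
have hS0 : clsub S0 by apply: setI2_clsub => //; apply: orth_clsub.
have hs0 := clsub_sub hS0.
have rsymB x z : rip (B x) z = rip x (B z) by rewrite /rip symB.
have linB : lin_on setT B by apply: lin_onT.
(* The isometry sends [p + r] to [q + U r]. As [M0] need not be closed, such sums [p + r] are only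
   dense in [S]. *)
pose G x y := exists p q v r, [/\ Q p q v, S r, orth ip M0 r, x = p + r & y = q + U r].
have inS0 r : S r -> orth ip M0 r -> S0 r.
  by move=> sr or; split=> // k /KM; apply: or.
have hM0 : is_subspace M0.
  split; first by exists 0, 0.
  by move=> a x y [q [v h]] [q' [v' h']]; exists (a *: q + q'), (a *: v + v'); apply: Qlin.
have hN0 : is_subspace N0.
  split; first by exists 0, 0.
  by move=> a x y [q [v h]] [q' [v' h']]; exists (a *: q + q'), (a *: v + v'); apply: Qlin.
have ort p q v r : Q p q v -> S r -> orth ip M0 r -> rip p r = 0 /\ rip q (U r) = 0.
  move=> h sr or; split; rewrite ripC; apply: ip0_rip; first by apply: or; exists q, v.
  by have /hr[h1 _] := inS0 r sr or; apply: h1 => //; exists p, v.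
apply: (@graph_common_complement S T G beta hS hT b1).
- exists 0, 0, 0, 0; split=> //; rewrite ?addr0 //; first by case: hs.
    by case: (orth_subspace M0).
  by rewrite (lin_on0 hs0 lU) addr0.
- move=> a _ _ _ _ [p [q [v [r [h sr or -> ->]]]]] [p' [q' [v' [r' [h' sr' or' -> ->]]]]].
  exists (a *: p + p'), (a *: q + q'), (a *: v + v'), (a *: r + r'); split.
  + exact: Qlin.
  + by case: hs => _; apply.
  + by case: (orth_subspace M0) => _; apply.
  + by rewrite scalerDr addrACA.
  + by rewrite lU ?scalerDr 1?addrACA //; apply: inS0.
- move=> _ _ [p [q [v [r [h sr or -> ->]]]]]; have [sp tq sv _ _] := Qst _ _ _ h.
  by split; apply: subspaceD => //; have [] := UT0 _ (inS0 _ sr or).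
- move=> _ _ [p [q [v [r [h sr or -> ->]]]]]; have [_ _ _ e _] := Qst _ _ _ h.
  have [o1 o2] := ort _ _ _ _ h sr or; rewrite /nrm; congr (Num.sqrt _).
  rewrite !ripDl !ripDr (ripC r) (ripC (U r)) o1 o2 -(sqr_nrm p) -(sqr_nrm q) e.
  by rewrite [in RHS]/rip ipU //; apply: inS0.
- move=> _ _ [p [q [v [r [h sr or -> ->]]]]]; have [sp tq sv e nv] := Qst _ _ _ h.
  have [o1 o2] := ort _ _ _ _ h sr or.
  (* Paired with vectors of [S], [q + U r] acts as [B g] with [g = v + r]. For [f = p + r],
     polarization then leaves [f - g = p - v], whose norm is at most [2 |p| <= 2 |f|]. *)
  have -> : rip (p + r) (q + U r) = rip (p + r) (B (v + r)).
    have spr : S (p + r) by apply: subspaceD.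
    rewrite (lin_onD linB) // !ripDr /rip (Qip _ _ _ _ h spr) Uip //; exact: inS0.
  have := posB (p + r + (v + r)); have := Qb _ _ _ h.
  have -> : p - v = (p + r) - (v + r) by rewrite opprD addrACA subrr addr0.
  have h1 : rip (p + r - (v + r)) (p + r - (v + r)) <= 4 * rip (p + r) (p + r).
    have -> : p + r - (v + r) = p - v by rewrite opprD addrACA subrr addr0.
    have n2 : nrm (p - v) <= 2 * nrm p by have := nrmB p v; lra.
    have := nrm_sqr_le (mulr_ge0 (ler0n R 2) (nrm_ge0 p)) n2; rewrite exprMn sqr_nrm.
    have : rip (p + r) (p + r) = rip p p + rip r r by rewrite ripDl !ripDr (ripC r p) o1; ring.
    by have := rip_ge0 r; lra.
  move: h1; move: (p + r) (v + r) => f g h1.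
  move=> h3; have {h3} := le_trans h3 (ler_wpM2l b0 h1).
  rewrite (lin_onB _ linB) // rsymB (lin_onD linB) //.
  rewrite [rip (f - g) (B f - B g)]ripBl !(ripDl, ripNl) !(ripDr, ripNr) -(rsymB g f) (ripC (B g)) => h3 h4.
  by lra.
(* [s] is its projection onto the closure of [M0], approximated by some [p'] of [M0], plus a
   remainder on which the isometry is [U]. *)
- move=> s ss e e0; have hA := adh_closed_subspace hM0.
  have [p' [q [v h]] hp] := @oproj_in _ s hA _ e0.
  have or : orth ip M0 (s - P (adh M0) s).
    by move=> m mm; apply: (oproj_orth s hA); apply: sub_adh.
  exists (p' + (s - P (adh M0) s)).
    exists (q + U (s - P (adh M0) s)), p', q, v, (s - P (adh M0) s); split=> //.
    apply: subspaceB => //; apply: closed_adh => // d d0.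
    by have [x [y [w hx]] hd] := @oproj_in _ s hA _ d0; exists x => //; have [] := Qst _ _ _ hx.
  by rewrite addrCA opprD addrA subrr add0r opprB.
- move=> t tt e e0; have hA := adh_closed_subspace hN0.
  have [q' [p [v h]] hp] := @oproj_in _ t hA _ e0.
  set r' := t - P (adh N0) t.
  have or : orth ip N0 r' by move=> m mm; apply: (oproj_orth t hA); apply: sub_adh.
  have T0r : T0 r'.
    split; last by move=> n /NN; apply: or.
    apply: subspaceB => //; apply: closed_adh => // d d0.
    by have [x [y [w hx]] hd] := @oproj_in _ t hA _ d0; exists x => //; have [] := Qst _ _ _ hx.
  have [r S0r Ur] := ontoU _ T0r.
  exists (q' + r').
    exists (p + r), p, q', v, r; split=> //; [by case: S0r | by apply/hr => //; rewrite Ur | by rewrite Ur].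
  by rewrite /r' addrCA opprD addrA subrr add0r opprB.
Qed.

(** * Matching orthonormal sequences in the two cases *)

Definition fspan (f : nat -> V) : set V :=
  fun x => exists N (c : nat -> R[i]), x = \sum_(i < N) c i *: f i.

Lemma comb_merge (a : R[i]) N (c : nat -> R[i]) N' (c' : nat -> R[i]) : exists N'' (c'' : nat -> R[i]),
  forall f : nat -> V, a *: (\sum_(i < N) c i *: f i) + \sum_(i < N') c' i *: f i =
    \sum_(i < N'') c'' i *: f i.
Proof.
exists (maxn N N'), (fun i => a * (if (i < N)%N then c i else 0) + (if (i < N')%N then c' i else 0)) => f.
have pad n (d : nat -> R[i]) m : (n <= m)%N ->
    \sum_(i < n) d i *: f i = \sum_(i < m) (if (i < n)%N then d i else 0) *: f i.
  move=> nm; rewrite (big_ord_widen m (fun i => d i *: f i) nm) big_mkcond /=.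
  by apply: eq_bigr => i _; case: ifP => // _; rewrite scale0r.
rewrite (pad N c _ (leq_maxl N N')) (pad N' c' _ (leq_maxr N N')) scaler_sumr -big_split /=.
by apply: eq_bigr => i _; rewrite scalerDl scalerA.
Qed.

Lemma fspan_subspace f : is_subspace (fspan f).
Proof.
split; first by exists 0%N, (fun=> 0); rewrite big_ord0.
move=> a _ _ [N [c ->]] [N' [c' ->]]; have [N'' [c'' ->]] := comb_merge a N c N' c'.
by exists N'', c''.
Qed.

Lemma fspan_mem f i : fspan f (f i).
Proof.
exists i.+1, (fun j => (j == i)%:R); rewrite big_ord_recr /= eqxx scale1r big1 ?add0r // => j _.
by rewrite ltn_eqF // scale0r.
Qed.

(** Used with [g = f] for norms and with [g i = B (f i)] for the quadratic form of [B]. *)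
Lemma rip_sum_diag (f g : nat -> V) N (c : nat -> R[i]) :
  (forall i j, i != j -> ip (f i) (g j) = 0) ->
  rip (\sum_(i < N) c i *: f i) (\sum_(i < N) c i *: g i) =
  \sum_(i < N) (complex.Re (c i) ^+ 2 + complex.Im (c i) ^+ 2) * rip (f i) (g i).
Proof.
move=> o; elim: N => [|N IH]; first by rewrite !big_ord0 rip0l.
rewrite !big_ord_recr /= ripDl !ripDr IH rip_normZ.
have -> : rip (\sum_(i < N) c i *: f i) (c N *: g N) = 0.
  apply: ip0_rip; rewrite ip_suml big1 // => i _.
  by rewrite ipZl ipZr o ?mulr0 // ltn_eqF.
have -> : rip (c N *: f N) (\sum_(i < N) c i *: g i) = 0.
  apply: ip0_rip; rewrite ip_sumr big1 // => i _.
  by rewrite ipZl ipZr o ?mulr0 // gtn_eqF.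
ring.
Qed.

Lemma orthonormal_isometry (f g : nat -> V) a (c : nat -> R[i]) : orthonormal f a -> orthonormal g a ->
  nrm (\sum_(i < a) c i *: f i) = nrm (\sum_(i < a) c i *: g i).
Proof.
move=> hf hg; rewrite /nrm /rip; congr (Num.sqrt (complex.Re _)).
rewrite !ip_suml; apply: eq_bigr => i _; rewrite !ip_sumr; apply: eq_bigr => j _.
by rewrite !ipZl !ipZr hf // hg.
Qed.

Lemma orth_fprojK S k a r : (forall x, S x -> fproj k a x = x) ->
  (forall i, (i < a)%N -> ip r (k i) = 0) -> orth ip S r.
Proof.
move=> pk h x sx; rewrite -(pk x sx) ip_sumr big1 // => i _.
by rewrite ipZr h ?mulr0.
Qed.

(** [Q] matches orthonormal bases of [K] and [N], with [v = 0]. Since [B] vanishes on [K],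
    [beta = 0] is allowed. *)
Lemma equal_defect_common_complement S T a : clsub S -> clsub T ->
  has_dim (setI2 S (orth ip T)) a -> has_dim (setI2 (orth ip S) T) a ->
  common_complement ip S T.
Proof.
move=> hS hT hK hN; have [B [U]] := polar_decomposition hS hT.
set K := setI2 S (orth ip T) in hK *; set N := setI2 (orth ip S) T in hN *.
move=> /= [[lB symB posB nB SB] lU UT0 [ipU ontoU] Uip].
have hTo := orth_clsub T; have hSo := orth_clsub S.
have sK : is_subspace K by apply: clsub_sub; apply: setI2_clsub.
have sN : is_subspace N by apply: clsub_sub; apply: setI2_clsub.
have [k [ok kK pk]] := has_dim_orthonormal sK hK.
have [c [oc cN pc]] := has_dim_orthonormal sN hN.
have B0 : B 0 = 0 by apply: (@lin_on0 setT) => //; apply: lin_onT.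
pose Q (p q v : V) := v = 0 /\ exists x : nat -> R[i], p = \sum_(i < a) x i *: k i /\ q = \sum_(i < a) x i *: c i.
have QK p q v : Q p q v -> K p.
  by move=> [_ [x [-> _]]]; apply: subspace_sum => // i _; apply: subspaceZ => //; apply: kK.
have QN p q v : Q p q v -> N q.
  by move=> [_ [x [_ ->]]]; apply: subspace_sum => // i _; apply: subspaceZ => //; apply: cN.
apply: (@glue_common_complement S T B U Q 0) => //.
- by rewrite lexx ltr01.
- by split=> //; exists (fun=> 0); split; rewrite big1 // => i _; rewrite scale0r.
- move=> r _ _ _ _ _ _ [-> [x [-> ->]]] [-> [x' [-> ->]]]; split; first by rewrite scaler0 addr0.
  exists (fun i => r * x i + x' i); rewrite !scaler_sumr -!big_split.
  by split; apply: eq_bigr => i _; rewrite scalerDl scalerA.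
- move=> p q v h; have [sp _] := QK _ _ _ h; have [_ tq] := QN _ _ _ h.
  case: h => -> [x [ep eq]]; split=> //; first by case: hS => -[].
    by rewrite ep eq; apply: orthonormal_isometry.
  by rewrite nrm0 nrm_ge0.
- move=> p q v s h ss; have [oq _] := QN _ _ _ h; case: h => -> _.
  by rewrite B0 ip0r; apply: orth_mem oq.
- move=> p q v h; have [sp op] := QK _ _ _ h; case: h => -> _; rewrite subr0 mul0r.
  suff -> : B p = 0 by rewrite rip0r.
  by apply: rip_eq0; rewrite nB // oproj_0 // rip0l.
- move=> x Kx; exists (\sum_(i < a) ip x (k i) *: c i), 0; split=> //.
  by exists (fun i => ip x (k i)); split=> //; rewrite -[LHS](pk x Kx).
- move=> x Nx; exists (\sum_(i < a) ip x (c i) *: k i), 0; split=> //.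
  by exists (fun i => ip x (c i)); split=> //; rewrite -[LHS](pc x Nx).
- move=> r S0r; split=> _ w [p [v h]]; last by case: S0r => _; apply; apply: QK h.
  by have [_ h'] := UT0 _ S0r; apply: h'; apply: QN h.
Qed.

Lemma noncompact_common_complement S T a b : clsub S -> clsub T ->
  has_dim (setI2 S (orth ip T)) a -> has_dim (setI2 (orth ip S) T) b ->
  ~ compact_op ip (fun x => P S (P (orth ip T) x)) -> common_complement ip S T.
Proof.
move=> hS hT hK hN hnc; have [B [U]] := polar_decomposition hS hT.
set K := setI2 S (orth ip T) in hK *; set N := setI2 (orth ip S) T in hN *.
move=> /= [[lB symB posB nB SB] lU UT0 [ipU ontoU] Uip].
have hTo := orth_clsub T; have hSo := orth_clsub S.
have hs := clsub_sub hS; have ht := clsub_sub hT.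
have sK : is_subspace K by apply: clsub_sub; apply: setI2_clsub.
have sN : is_subspace N by apply: clsub_sub; apply: setI2_clsub.
have [k [ok kK pk]] := has_dim_orthonormal sK hK.
have [c [oc cN pc]] := has_dim_orthonormal sN hN.
have linB : lin_on setT B by apply: lin_onT.
have B0 : B 0 = 0 by apply: (@lin_on0 setT).
have [eps eps0 hex] := noncompact_extend hS hTo hnc.
(* Starting the list with the [k i] keeps the sequence orthogonal to [K], and passing [B] makes [B]
   diagonal on it. *)
have [|e [he oL oe oBe]] := @greedy_sequence (fun e => [/\ S e, nrm e = 1 & eps <= nrm (P (orth ip T) e)])
    B (mkseq k a).
  by move=> L; have [e [se ne ee oe]] := hex L; exists e.
have Se j : S (e j) by case: (he j).
have ke i j : (i < a)%N -> ip (e j) (k i) = 0.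
  by move=> ia; apply: oL; apply/(nthP 0); exists i; rewrite ?size_mkseq ?nth_mkseq.
have S0e j : part_orth S K (e j).
  by split=> //; apply: (orth_fprojK pk) => i; apply: ke.
have BK x : K x -> B x = 0.
  by move=> [sx ox]; apply: rip_eq0; rewrite nB // oproj_0 // rip0l.
have oee i j : ip (e i) (e j) = (i == j)%:R.
  have [<-|ij] := eqVneq i j; first by apply/rip_unit; case: (he i).
  have [ltij|ltji|eij] := ltngtP i j; [|exact: oe|by rewrite eij eqxx in ij].
  by apply: ip_sym0; apply: oe.
have oeB i j : i != j -> ip (e i) (B (e j)) = 0.
  move=> ij; have [ltij|ltji|eij] := ltngtP i j; [|exact: oBe|by rewrite eij eqxx in ij].
  by rewrite -symB; apply: ip_sym0; apply: oBe.
(* From [0 <= |e - B e|^2] and [|B e| = |P_T e|]: [2 <e, B e> <= 1 + |P_T e|^2 = 2 - |P_{T^perp}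
   e|^2 <= 2 - eps^2]. *)
pose beta := 1 - eps ^+ 2 / 2.
have eps1 : eps <= 1.
  by have [_ n1 h] := he 0%N; rewrite -n1; apply: le_trans h (nrm_oproj _ hTo).
have beta0 : 0 <= beta by rewrite /beta; nra.
have beta1 : beta < 1 by rewrite /beta; nra.
have eBe j : rip (e j) (B (e j)) <= beta.
  have [sj nj hj] := he j; have := rip_ge0 (e j - B (e j)).
  rewrite ripBl !ripBr (ripC (B (e j)) (e j)) nB // -(sqr_nrm (e j)) nj.
  have := oproj_pythagoras (e j) hT; rewrite -oprojC // -(sqr_nrm (e j)) nj.
  rewrite -(sqr_nrm (P (orth ip T) _)).
  have : eps ^+ 2 <= nrm (P (orth ip T) (e j)) ^+ 2 by rewrite ler_pXn2r ?nnegrE ?nrm_ge0 ?(ltW eps0).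
  by rewrite /beta; lra.
(* The isometry sends [m i] to [n i]. The vector [w i] is the preimage of [n i] under [U], or [0]
   when [n i] belongs to [N] and is therefore orthogonal to [S]. *)
pose m i := if (i < a)%N then k i else e (i - a)%N.
pose n i := if (i < b)%N then c i else U (e (i - b)%N).
pose w i := if (i < b)%N then 0 else e (i - b)%N.
have om M : orthonormal m M.
  move=> i j _ _; rewrite /m; case: ltnP => ia; case: ltnP => ja.
  - exact: ok.
  - by rewrite ip_sym0 ?ke // ltn_eqF // (leq_trans ia).
  - by rewrite ke // gtn_eqF // (leq_trans ja).
  - by rewrite oee -(eqn_add2r a) !subnK.
have on M : orthonormal n M.
  have cU i j : (i < b)%N -> ip (U (e j)) (c i) = 0.
    by move=> ib; have [_ h] := UT0 _ (S0e j); apply: h; apply: cN.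
  move=> i j _ _; rewrite /n; case: ltnP => ia; case: ltnP => ja.
  - exact: oc.
  - by rewrite ip_sym0 ?cU // ltn_eqF // (leq_trans ia).
  - by rewrite cU // gtn_eqF // (leq_trans ja).
  - by rewrite ipU // oee -(eqn_add2r b) !subnK.
have om' i j : i != j -> ip (m i) (m j) = 0.
  by move=> ij; rewrite (om (maxn i j).+1) ?ltnS ?leq_maxl ?leq_maxr // (negbTE ij).
have ow i j : i != j -> ip (w i) (w j) = 0.
  move=> ij; rewrite /w; case: ltnP => ia; first by rewrite ip0l.
  case: ltnP => ja; first by rewrite ip0r.
  by rewrite oee -(eqn_add2r b) !subnK // (negbTE ij).
have Sm i : S (m i) by rewrite /m; case: ifP => // /kK[].
have Tn i : T (n i).
  by rewrite /n; case: ifP => [/cN[] //|_]; have [] := UT0 _ (S0e (i - b)%N).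
have Sw i : S (w i) by rewrite /w; case: ifP => // _; case: hs.
have em j : e j = m (a + j)%N by rewrite /m ltnNge leq_addr /= addKn.
have Uen j : U (e j) = n (b + j)%N by rewrite /n ltnNge leq_addr /= addKn.
have wm i : fspan m (w i).
  rewrite /w; case: ifP => _; first by case: (fspan_subspace m).
  by rewrite em; apply: fspan_mem.
(* [B] is diagonal on the [m i], with entry [0] at vectors of [K] and at most [beta] at the [e j].
   The bound will be used at [p - v], which is in the span since each [w i] is. *)
have mB f : fspan m f -> rip f (B f) <= beta * rip f f.
  move=> [M [x ->]]; rewrite (lin_on_sum (S := setT) _ linB) //.
  rewrite (rip_sum_diag (g := fun i => B (m i))) ?rip_sum_diag //; last first.
    move=> i j ij; rewrite /m; case: ltnP => ia; first by rewrite -symB BK ?ip0l //; apply: kK.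
    case: ltnP => ja; first by rewrite BK ?ip0r //; apply: kK.
    by apply: oeB; rewrite -(eqn_add2r a) !subnK.
  rewrite mulr_sumr; apply: ler_sum => i _; rewrite mulrCA ler_wpM2l ?addr_ge0 ?sqr_ge0 //.
  have -> : rip (m i) (m i) = 1 by rewrite /rip (om i.+1) // eqxx.
  rewrite mulr1 /m; case: ifP => ia; last exact: eBe.
  by rewrite BK ?rip0r //; apply: kK.
pose Q (p q v : V) := exists M (x : nat -> R[i]), [/\ p = \sum_(i < M) x i *: m i,
  q = \sum_(i < M) x i *: n i & v = \sum_(i < M) x i *: w i].
have Qm i : Q (m i) (n i) (w i).
  exists i.+1, (fun j => (j == i)%:R).
  by split; rewrite big_ord_recr /= eqxx scale1r big1 ?add0r // => j _; rewrite ltn_eqF // scale0r.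
apply: (@glue_common_complement S T B U Q beta) => //.
- by rewrite beta0.
- by exists 0%N, (fun=> 0); rewrite !big_ord0.
- move=> r _ _ _ _ _ _ [M [x [-> -> ->]]] [M' [x' [-> -> ->]]].
  by have [M'' [x'' h]] := comb_merge r M x M' x'; exists M'', x''; rewrite !h.
- move=> p q v [M [x [-> -> ->]]]; split.
  + by apply: subspace_sum => // i _; apply: subspaceZ.
  + by apply: subspace_sum => // i _; apply: subspaceZ.
  + by apply: subspace_sum => // i _; apply: subspaceZ.
  + exact: orthonormal_isometry.
  + apply: nrm_le; rewrite !rip_sum_diag //.
    apply: ler_sum => i _; rewrite ler_wpM2l ?addr_ge0 ?sqr_ge0 //.
    have -> : rip (m i) (m i) = 1 by rewrite /rip (om i.+1) // eqxx.
    by rewrite /w; case: ifP => _; rewrite ?rip0l // /rip oee eqxx.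
- move=> p q v s [M [x [_ -> ->]]] ss; rewrite (lin_on_sum (S := setT) _ linB) // !ip_sumr.
  apply: eq_bigr => i _; rewrite !ipZr; congr (_ * _); rewrite /n /w; case: ifP => ib.
    by rewrite B0 ip0r; apply: orth_mem ss _; case: (cN i ib).
  exact: Uip.
- move=> p q v [M [x [-> _ ->]]]; apply: mB; apply: (subspaceB (fspan_subspace m)).
    by apply: (subspace_sum _ (fspan_subspace m)) => i _; apply: (subspaceZ _ (fspan_subspace m)); apply: fspan_mem.
  by apply: (subspace_sum _ (fspan_subspace m)) => i _; apply: (subspaceZ _ (fspan_subspace m)).
- move=> x Kx; exists (\sum_(i < a) ip x (k i) *: n i), (\sum_(i < a) ip x (k i) *: w i).
  exists a, (fun i => ip x (k i)); split=> //; rewrite -[LHS](pk x Kx).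
  by apply: eq_bigr => i _; rewrite /m ltn_ord.
- move=> x Nx; exists (\sum_(i < b) ip x (c i) *: m i), (\sum_(i < b) ip x (c i) *: w i).
  exists b, (fun i => ip x (c i)); split=> //; rewrite -[LHS](pc x Nx).
  by apply: eq_bigr => i _; rewrite /n ltn_ord.
(* As [r] is orthogonal to [K] and [U r] to [N], both conditions say that [r] is orthogonal to every
   [e j]. *)
- move=> r S0r; split=> h z [p [v [M [x]]]].
    move=> [_ -> _]; rewrite ip_sumr big1 // => i _; rewrite ipZr (_ : ip _ (n i) = 0) ?mulr0 //.
    rewrite /n; case: ifP => ib; first by have [_ h'] := UT0 _ S0r; apply: h'; apply: cN.
    by rewrite ipU // em; apply: h; eexists; eexists; apply: Qm.
  move=> [-> _ _]; rewrite ip_sumr big1 // => i _; rewrite ipZr (_ : ip _ (m i) = 0) ?mulr0 //.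
  rewrite /m; case: ifP => ia; first by have [_ h'] := S0r; apply: h'; apply: kK.
  by rewrite -ipU // Uen; apply: h; eexists; eexists; apply: Qm.
Qed.

End HilbertSpace.

Theorem mainTheorem6 (R : realType) (V : lmodType R[i]) (ip : V -> V -> R[i])
  (HV : is_sep_inf_hilbert ip) (S T : set V)
  (hS : closed_subspace ip S) (hT : closed_subspace ip T)
  (hSinf : ~ finite_dim S) (hScoinf : ~ finite_dim (orth ip S))
  (hTinf : ~ finite_dim T) (hTcoinf : ~ finite_dim (orth ip T)) :
  (inGamma ip (oproj ip S) (oproj ip T)
     /\ finite_dim (setI2 S (orth ip T))
     /\ finite_dim (setI2 (orth ip S) T))
  <->
  (inC1 ip (oproj ip S) (oproj ip (orth ip T))
     /\ ind (oproj ip S) (oproj ip (orth ip T)) != 0).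
Proof.
have hTo := orth_clsub HV T.
(* The kernel of [P_{T^perp}] is the double complement of [T], that is [T], so the index compares
   the dimensions of [K] and [N]. *)
rewrite /inGamma /inDelta /inC1 /inC /ind !range_oproj // !kernel_oproj // orth_orth //.
split=> [[hno [[a ha] [b hb]]]|[[hc _ _ [b hb]] hind]].
  split; first (split=> //; last by exists b).
    by apply: contrapT => hnc; apply: hno; apply: noncompact_common_complement ha hb hnc.
  rewrite (fdimE ha) (fdimE hb) subr_eq0; apply/eqP => -[eab]; apply: hno.
  by rewrite -eab in hb; apply: equal_defect_common_complement ha hb.
(* Compactness makes [K] finite dimensional, so that [fdim] is its true dimension in the index. *)
have [a ha] := compact_finite_dim_meet HV hS hTo hc.
split; last by split; [exists a | exists b].
move=> hcc; have eab := no_common_complement HV hS hT hc ha hb hcc.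
by move: hind; rewrite (fdimE ha) (fdimE hb) eab subrr eqxx.
Qed.
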